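(* Let $r\ge 2$ be an integer and $q\ge2$ a prime power. For $n\ge 2$ with smallest prime divisor $\ell$ let $$\epsilon_{r,n}(q)=\frac{q^{\ell\left(\binom{r+n/\ell}{r}-1\right)}}{\ell(1-q^{-\ell})},\qquad \kappa=(\ell-1)\Bigl(\binom{r-1+n/\ell}{r-1}-r\Bigr)+1.$$ (i) $\#E_{r,1}(\mathbb{F}_q)=0$. (ii) If $n$ is prime, then $$\#E_{r,n}(\mathbb{F}_q)=\epsilon_{r,n}(q)\,(1-q^{-nr})\Bigl(1-q^{-r(n-1)}\,\frac{(1-q^{-r})(1-q^{-n})}{(1-q^{-1})(1-q^{-nr})}\Bigr),$$ $$0\le\epsilon_{r,n}(q)-\#E_{r,n}(\mathbb{F}_q)\le\epsilon_{r,n}(q)\cdot 3\,q^{-r(n-1)}.$$ (iii) If $n$ is composite, then $$\bigl|\#E_{r,n}(\mathbb{F}_q)-\epsilon_{r,n}(q)\bigr|\le\epsilon_{r,n}(q)\cdot 3\,q^{-\kappa}.$$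
   Context: $\mathbb{F}_q$ is the finite field with $q$ elements. Fix a monomial order (say degree-lexicographic) on $\mathbb{F}_q[x_1,\dots,x_r]$; a polynomial is monic if its leading coefficient is $1$. $E_{r,n}(\mathbb{F}_q)$ is the set of monic polynomials in $\mathbb{F}_q[x_1,\dots,x_r]$ of total degree exactly $n$ that are relatively irreducible, i.e. irreducible over $\mathbb{F}_q$ but not absolutely irreducible (not irreducible over an algebraic closure of $\mathbb{F}_q$). *)

(* Defs.v *)
From HB Require Import structures.
From mathcomp Require Import all_boot all_order all_algebra all_field.
From mathcomp Require Import finmap.
From mathcomp Require Import mpoly.
From mathcomp Require Import classical_sets cardinality.

Set Implicit Arguments.
Unset Strict Implicit.
Unset Printing Implicit Defensive.

Import GRing.Theory.

Local Open Scope ring_scope.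

Definition mirreducible (k : fieldType) (r : nat) (p : {mpoly k[r]}) : Prop :=
  [/\ p != 0, p \isn't a GRing.unit &
      forall a b : {mpoly k[r]},
        p = a * b -> a \is a GRing.unit \/ b \is a GRing.unit].

Definition relatively_irreducible (F K : fieldType) (iota : {rmorphism F -> K})
    (r : nat) (p : {mpoly F[r]}) : Prop :=
  mirreducible p /\ ~ mirreducible (map_mpoly iota p).

(* [mleadc] is taken with respect to the order of mpoly on monomials, which
   compares total degrees first and then exponent vectors lexicographically;
   [msize p] is the total degree of [p] plus one. *)
Definition rel_irr_set (F K : fieldType) (iota : {rmorphism F -> K})
    (r n : nat) : set {mpoly F[r]} :=
  [set p | [/\ mleadc p = 1, msize p = n.+1 & relatively_irreducible iota p]]%classic.

Arguments rel_irr_set {F K} iota r n _.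

Definition epsilon (r n q : nat) : rat :=
  let l := pdiv n in
  q%:R ^+ (l * ('C(r + n %/ l, r) - 1)) / (l%:R * (1 - q%:R ^- l)).

Definition kappa (r n : nat) : int :=
  let l := pdiv n in
  (l%:Z - 1) * ('C(r - 1 + n %/ l, r - 1)%:Z - r%:Z) + 1.

(* Main.v *)
Require Import Defs.
From HB Require Import structures.
From mathcomp Require Import all_boot all_order all_algebra.
From mathcomp Require Import all_fingroup all_solvable all_field.
From mathcomp Require Import finmap.
From mathcomp Require Import mpoly.
From mathcomp Require Import boolp classical_sets cardinality.
From mathcomp Require Import zify ring lra.

(**
Let [phi] be the [q]-power Frobenius map of [K] and [Phi] its coefficientwise
action on polynomials. By Gauss' lemma irreducible polynomials over [K] are
prime, so the relatively irreducible polynomials of degree [n] over [F] are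
exactly the products [g * Phi g * ... * Phi^(j-1) g] over the [Phi]-orbits of
length [j > 1] of monic absolutely irreducible [g] of degree [d = n / j]. Each
orbit has [j] elements, and the [g] of a given [j] have coefficients in the field
with [q ^ j] elements.

If [n] is prime, only [j = n], [d = 1] occurs and every monic linear [g] not
fixed by [Phi] counts, which gives the closed formula. In general the main
contribution is that of the smallest [j], namely [l = pdiv n]. With
[m = n / l], [N d = 'C(r + d, r)] and [b d = 'C(r - 1 + d, r - 1)], multiplying
the claim by [l * (q ^ l - 1)] turns the error term into [3 * q ^ U] with
[U = l * (N (m - 1) + r) + (b m - r - 1)]. The other [d] contribute at most
[2 * q ^ U] in total; the monic polynomials of degree [m] over the field with
[q ^ l] elements that are not absolutely irreducible with orbit length [l] are
reducible, relatively irreducible or defined over [F], and there are few of them.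
All exponent comparisons follow from the convexity of [b].
*)

Set Implicit Arguments.
Unset Strict Implicit.
Unset Printing Implicit Defensive.

Import Order.TTheory GRing.Theory Num.Theory.

Local Open Scope ring_scope.

(** * Gauss' lemma *)

(* On [{mpoly k[n]}] this is convertible to [mirreducible]. *)
Definition irreducible_elt (R : idomainType) (p : R) : Prop :=
  [/\ p != 0, p \isn't a GRing.unit &
      forall a b : R, p = a * b -> a \is a GRing.unit \/ b \is a GRing.unit].

Definition divides (R : idomainType) (d a : R) : Prop := exists c, a = c * d.

Definition prime_elt (R : idomainType) (p : R) : Prop :=
  forall a b, divides p (a * b) -> divides p a \/ divides p b.

Section DividesTheory.
Variable R : idomainType.
Implicit Types a b d : R.

Lemma divides_mull d a b : divides d b -> divides d (a * b).
Proof. by case=> c ->; exists (a * c); rewrite mulrA. Qed.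

Lemma divides_mulr d a b : divides d a -> divides d (a * b).
Proof. by rewrite mulrC; apply: divides_mull. Qed.

Lemma dividesD d a b : divides d a -> divides d b -> divides d (a + b).
Proof. by case=> x -> [y ->]; exists (x + y); rewrite mulrDl. Qed.

Lemma dividesB d a b : divides d a -> divides d b -> divides d (a - b).
Proof. by case=> x -> [y ->]; exists (x - y); rewrite mulrBl. Qed.

End DividesTheory.

Section GaussLemma.
Variable R : idomainType.
(** Together the two hypotheses say that [R] is factorial. *)
Hypothesis irr_prime : forall p : R, irreducible_elt p -> prime_elt p.
Hypothesis irr_factors : forall c : R, c != 0 ->
  exists (s : seq R) (u : R), [/\ u \is a GRing.unit,
    forall x, x \in s -> irreducible_elt x & c = u * \prod_(x <- s) x].

Lemma prime_polyC (x : R) : prime_elt x -> prime_elt (x%:P).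
Proof.
(* [x] divides one of the two leading coefficients, so that term can be dropped. *)
move=> px f g; move: {2}(size f + size g)%N (leqnn (size f + size g)) => n.
elim: n f g => [|n IHn] f g.
  rewrite leqn0 addn_eq0 => /andP[/eqP sf _] _.
  by left; exists 0; rewrite mul0r; apply/eqP; rewrite -size_poly_eq0 sf.
move=> le_n x_fg.
have [-> | f0] := eqVneq f 0; first by left; exists 0; rewrite mul0r.
have [-> | g0] := eqVneq g 0; first by right; exists 0; rewrite mul0r.
have xlead (h : {poly R}) : divides x (lead_coef h) ->
    divides x%:P (lead_coef h *: 'X^((size h).-1)).
  by case=> c ->; exists (c *: 'X^((size h).-1)); rewrite -!mul_polyC polyCM; ring.
have szB (h : {poly R}) : h != 0 ->
    (size (h - lead_coef h *: 'X^((size h).-1))%R < size h)%N.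
  move=> h0; have sh : (0 < size h)%N by rewrite size_poly_gt0.
  rewrite -[X in (_ < X)%N](prednK sh) ltnS; apply/leq_sizeP => j.
  rewrite leq_eqVlt => /predU1P[<- | lt_j]; rewrite coefB coefZ coefXn.
    by rewrite eqxx mulr1 subrr.
  by rewrite (gtn_eqF lt_j) mulr0 subr0 nth_default // -(prednK sh).
have /px[xf|xg] : divides x (lead_coef f * lead_coef g).
- rewrite -lead_coefM; case: x_fg => c ->.
  by exists (lead_coef c); rewrite lead_coefM lead_coefC.
- case: (IHn (f - lead_coef f *: 'X^((size f).-1)) g).
  + by rewrite -ltnS; apply: leq_trans le_n; rewrite ltn_add2r; apply: szB.
  + by rewrite mulrBl; apply: dividesB => //; apply/divides_mulr/xlead.
  + by move=> h; left; rewrite -(subrK (lead_coef f *: 'X^((size f).-1)) f);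
      apply: dividesD => //; apply: xlead.
  + by right.
- case: (IHn f (g - lead_coef g *: 'X^((size g).-1))).
  + by rewrite -ltnS; apply: leq_trans le_n; rewrite ltn_add2l; apply: szB.
  + by rewrite mulrBr; apply: dividesB => //; apply/divides_mull/xlead.
  + by left.
  + by move=> h; right; rewrite -(subrK (lead_coef g *: 'X^((size g).-1)) g);
      apply: dividesD => //; apply: xlead.
Qed.

(* A factorization over the fraction field of [R] can be rescaled to one over [R]. *)
Lemma clear_denominator (c : R) (a f g : {poly R}) : c != 0 -> c%:P * a = f * g ->
  exists e f' e' g', [/\ f = e%:P * f', g = e'%:P * g' & a = f' * g'].
Proof.
move=> /irr_factors[s [u [uu irr_s ->]]].
elim: s a f g irr_s => [|x s IHs] a f g irr_s.
  rewrite big_nil mulr1 => afg.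
  exists u, (u^-1%:P * f), 1, g; split.
  - by rewrite mulrA -polyCM divrr // mul1r.
  - by rewrite mul1r.
  - by rewrite -mulrA -afg mulrA -polyCM mulVr // mul1r.
rewrite big_cons => afg.
have irr_x : irreducible_elt x by apply: irr_s; rewrite mem_head.
have x0 : x%:P != 0 by case: irr_x => x0 _ _; rewrite polyC_eq0.
have irr_s' y : y \in s -> irreducible_elt y.
  by move=> ys; apply: irr_s; rewrite in_cons ys orbT.
(* Each irreducible factor [x] of the scalar stays prime as a constant polynomial, so it can be
   cancelled from [f] or from [g]. *)
have /(prime_polyC (irr_prime irr_x))[[f1 fE]|[g1 gE]] : divides x%:P (f * g).
- by exists ((u * \prod_(y <- s) y)%:P * a); rewrite -afg !polyCM; ring.
- have /(IHs _ _ _ irr_s')[e [f' [e' [g' [f1E g1E aE]]]]] :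
      (u * \prod_(y <- s) y)%:P * a = f1 * g.
    by apply: (mulfI x0); rewrite mulrA mulrA (mulrC _ f1) -fE -afg !polyCM; ring.
  exists (e * x), f', e', g'; split=> //.
  by rewrite fE f1E polyCM; ring.
- have /(IHs _ _ _ irr_s')[e [f' [e' [g' [f1E g1E aE]]]]] :
      (u * \prod_(y <- s) y)%:P * a = f * g1.
    by apply: (mulfI x0); rewrite mulrA mulrCA (mulrC _ g1) -gE -afg !polyCM; ring.
  exists e, f', (e' * x), g'; split=> //.
  by rewrite gE g1E polyCM; ring.
Qed.

(** Constants reduce to [R]. Otherwise pseudo-division gives gcd identities up to a nonzero scalar
    of [R]: either [p] is coprime to [a] and divides a multiple of [b], or the gcd is [p] up to
    scalars and [p] divides [a]. *)
Lemma irreducible_prime_poly (p : {poly R}) : irreducible_elt p -> prime_elt p.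
Proof.
move=> irr_p a b [c0 abE]; case: (irr_p) => p0 pNu pmul.
have [sp|sp] := leqP (size p) 1.
  have := size1_polyC sp; move: (p`_0) => c pE; rewrite pE.
  apply: prime_polyC; last by exists c0; rewrite -pE.
  apply: irr_prime; split=> [||x y xyE].
  - by move: p0; rewrite pE polyC_eq0.
  - by move: p0 pNu; rewrite pE polyC_eq0 poly_unitE coefC size_polyC => ->.
  have /pmul[] : p = x%:P * y%:P by rewrite -polyCM -xyE.
  - by rewrite poly_unitE coefC => /andP[]; left.
  - by rewrite poly_unitE coefC => /andP[]; right.
have polyC_unit (e : R) : e%:P \is a GRing.unit -> e \is a GRing.unit.
  by rewrite poly_unitE coefC => /andP[].
(* Divisibility up to a scalar suffices: the part of the scalar absorbed by [p] is a unit, since [p]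
   is irreducible of positive degree. *)
have dvd_p (e : R) (f h : {poly R}) : e != 0 -> e%:P * f = h * p -> divides p f.
  move=> e0 /(clear_denominator e0)[e1 [f' [e2 [g' [_ pE ->]]]]].
  case: (pmul _ _ pE) => [ue2|]; last first.
    move=> ug'; suff: (size p <= 1)%N by rewrite leqNgt sp.
    rewrite pE mul_polyC; apply: leq_trans (size_scale_leq _ _) _.
    by move: ug'; rewrite poly_unitE => /andP[/eqP->].
  exists (f' * e2^-1%:P); rewrite pE -!mulrA (mulrA _ e2%:P) -polyCM.
  by rewrite mulVr ?mul1r //; apply: polyC_unit.
have p_ab : p %| a * b by rewrite abE dvdp_mulIr.
case: (boolP (coprimep p a)) => [cop|Ncop].
  right; move: p_ab; rewrite Gauss_dvdpr // => /Pdiv.Idomain.dvdpP[[e h] /= e0 eE].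
  by apply: (dvd_p e b h) => //; rewrite mul_polyC.
left; set d := gcdp p a in Ncop *.
have d0 : d != 0 by rewrite gcdp_eq0 negb_and p0.
have /Pdiv.Idomain.dvdpP[[e h] /= e0] := dvdp_gcdl p a.
rewrite -mul_polyC -/d => /(clear_denominator e0)[e1 [f' [e2 [g' [_ dE pE]]]]].
case: (pmul _ _ pE) => [uf'|ug']; last first.
  have e20 : e2 != 0 by apply: contraNneq d0 => e20; rewrite dE e20 mul0r.
  case/negP: Ncop; rewrite coprimep_def -/d dE mul_polyC size_scale //.
  by move: ug'; rewrite poly_unitE => /andP[].
have /Pdiv.Idomain.dvdpP[[e3 h3] /= e30 aE] := dvdp_gcdr p a.
apply: (dvd_p e3 a (h3 * e2%:P * f'^-1)) => //; rewrite mul_polyC aE -/d dE pE.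
by rewrite -!mulrA (mulrA f'^-1) mulVr // mul1r.
Qed.

End GaussLemma.

(** * Multivariate polynomials as univariate polynomials in the last variable *)

Section MuniIso.
Variables (k : comNzRingType) (n : nat).

(** The inverse of [muni]: widen the coefficients, then evaluate at the last variable. *)
Definition mmultiv (p : {poly {mpoly k[n]}}) : {mpoly k[n.+1]} :=
  (map_poly (@mwiden n k) p).['X_ord_max].

Lemma muni_mwiden (c : {mpoly k[n]}) : muni (mwiden c) = c%:P.
Proof.
rewrite {1}(mpolyE c) (raddf_sum (@mwiden n k)).
rewrite (raddf_sum (@muni n k)). rewrite [in RHS](mpolyE c) (raddf_sum (@polyC _)) /=.
apply: eq_bigr => m _; rewrite mwidenZ muniZ mwidenX muniE msuppX big_seq1.
rewrite mcoeffX eqxx scale1r mnmwiden_ordmax expr0 -[X in _ = X%:P]mul_mpolyC.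
rewrite polyCM -mul_polyC alg_polyC; congr (_ * ('X_[_])%:P).
by apply/mnmP => i; rewrite mnmE mnmwiden_widen.
Qed.

Lemma muni_ord_max : muni ('X_ord_max : {mpoly k[n.+1]}) = 'X.
Proof.
rewrite muniE msuppX big_seq1 mcoeffX eqxx scale1r mnm1E eqxx expr1.
rewrite (_ : [multinom _ | i < n] = 0%MM) ?mpolyX0 ?scale1r //.
apply/mnmP=> i; rewrite !mnmE; case: eqP => // /(congr1 val) /= E.
by have := ltn_ord i; rewrite -E ltnn.
Qed.

Lemma mmultivK : cancel mmultiv (@muni n k).
Proof.
elim/poly_ind=> [|p c IHp]; first by rewrite /mmultiv rmorph0 horner0 rmorph0.
rewrite /mmultiv rmorphD rmorphM /= map_polyX map_polyC /= !hornerE.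
by rewrite rmorphD rmorphM /= -/(mmultiv p) IHp muni_ord_max muni_mwiden.
Qed.

Lemma muniK : cancel (@muni n k) mmultiv.
Proof.
move=> p; rewrite {1}(mpolyE p) [RHS](mpolyE p) (raddf_sum (@muni n k)) /mmultiv raddf_sum.
rewrite horner_sum /=; apply: eq_bigr => m _; rewrite muniZ map_polyZ hornerZ /= mwidenC.
rewrite mul_mpolyC; congr (_ *: _); rewrite muniE msuppX big_seq1 mcoeffX eqxx scale1r.
rewrite map_polyZ map_polyXn hornerZ hornerXn /= mwidenX mpolyXn -mpolyXD; congr 'X_[_].
apply/mnmP => i; rewrite mnmDE mulmnE mnm1E.
have [<- | ni] := eqVneq ord_max i.
  by rewrite mnmwiden_ordmax mul1n.
have lt_in : (i < n)%N.
  by have := ltn_ord i; rewrite ltnS leq_eqVlt => /predU1P[E|//]; case/eqP: ni; apply: val_inj.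
have -> : i = widen_ord (leqnSn n) (Ordinal lt_in) by apply: val_inj.
by rewrite mnmwiden_widen mnmE mul0n addn0.
Qed.
End MuniIso.

(** * Factorization into irreducibles and primality over a field *)

Section MpolyFactor.
Variables (k : fieldType) (n : nat).
Implicit Types p a b : {mpoly k[n]}.

Lemma mpoly_unit_msize p : (p \is a GRing.unit) = (msize p == 1%N).
Proof.
apply/idP/idP => [/andP[/eqP pE u0]|/msize_poly1P[c c0 ->]].
  by apply/msize_poly1P; exists p@_0; rewrite // -unitfE.
by apply: rmorph_unit; rewrite unitfE.
Qed.

Lemma msize_nonunit p : p != 0 -> p \isn't a GRing.unit -> (1 < msize p)%N.
Proof.
move=> p0; rewrite mpoly_unit_msize; have := p0.
by rewrite -msize_poly_eq0; case: (msize p) => [|[|]].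
Qed.

(** Strong induction on the degree: both factors of a proper factorization have smaller degree. *)
Lemma mpoly_factors p : p != 0 ->
  exists (s : seq {mpoly k[n]}) (u : {mpoly k[n]}), [/\ u \is a GRing.unit,
    forall x, x \in s -> irreducible_elt x & p = u * \prod_(x <- s) x].
Proof.
have [m] := ubnP (msize p); elim: m p => // m IHm p; rewrite ltnS => le_pm p0.
have [up|Nup] := boolP (p \is a GRing.unit).
  by exists [::], p; rewrite big_nil mulr1; split.
have [irr_p|Nirr] := EM (irreducible_elt p).
  by exists [:: p], 1; rewrite big_seq1 mul1r unitr1; split=> // x; rewrite inE => /eqP->.
have [a [b [pE Nua Nub]]] : exists a b,
    [/\ p = a * b, a \isn't a GRing.unit & b \isn't a GRing.unit].
  apply: contrapT => Nab; apply: Nirr; split=> // a b pE.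
  have [|Nua] := boolP (a \is a GRing.unit); first by left.
  have [|Nub] := boolP (b \is a GRing.unit); first by right.
  by case: Nab; exists a, b.
have a0 : a != 0 by apply: contraNneq p0 => a0; rewrite pE a0 mul0r.
have b0 : b != 0 by apply: contraNneq p0 => b0; rewrite pE b0 mulr0.
have := msize_nonunit a0 Nua; have := msize_nonunit b0 Nub; move=> sb sa.
have [lt_am lt_bm] : (msize a < m)%N /\ (msize b < m)%N.
  by move: le_pm; rewrite pE msizeM //; move: (msize a) (msize b) sa sb => x y; lia.
have [s [u [uu irr_s aE]]] := IHm a lt_am a0.
have [t [v [uv irr_t bE]]] := IHm b lt_bm b0.
exists (s ++ t), (u * v); split; first by rewrite unitrM uu.
  by move=> x; rewrite mem_cat => /orP[/irr_s|/irr_t].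
by rewrite pE [in LHS]aE [in LHS]bE big_cat /= mulrACA.
Qed.

Lemma irreducible_factor p : p != 0 -> p \isn't a GRing.unit ->
  exists2 d, irreducible_elt d & divides d p.
Proof.
move=> /mpoly_factors[[|d s] [u [uu irr_s ->]]] Nup.
  by move: Nup; rewrite big_nil mulr1 uu.
exists d; first by apply: irr_s; rewrite mem_head.
by exists (u * \prod_(x <- s) x); rewrite big_cons mulrCA mulrC.
Qed.

End MpolyFactor.

Lemma irreducible_prime_iso (R S : idomainType) (f : {rmorphism R -> S}) (g : S -> R) :
    cancel f g -> cancel g f ->
    (forall x : S, irreducible_elt x -> prime_elt x) ->
  forall x : R, irreducible_elt x -> prime_elt x.
Proof.
move=> fK gK irr_prime x [x0 Nux xmul].
have f_inj := can_inj fK.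
have unit_f (y : R) : f y \is a GRing.unit -> y \is a GRing.unit.
  move=> /unitrP[z [zy1 _]]; apply/unitrP; exists (g z).
  have gzy : g z * y = 1 by apply: f_inj; rewrite rmorphM rmorph1 gK.
  by rewrite [y * _]mulrC gzy.
have irr_fx : irreducible_elt (f x).
  split=> [||a b fxE].
  - by rewrite -(rmorph0 f) inj_eq.
  - by apply: contra Nux => /unit_f.
  have /xmul[/(rmorph_unit f)|/(rmorph_unit f)] : x = g a * g b.
  - by apply: f_inj; rewrite rmorphM !gK.
  - by rewrite gK; left.
  - by rewrite gK; right.
move=> a b [c abE].
have [|[d E]|[d E]] := irr_prime _ irr_fx (f a) (f b).
- by exists (f c); rewrite -!rmorphM abE.
- by left; exists (g d); apply: f_inj; rewrite rmorphM gK.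
- by right; exists (g d); apply: f_inj; rewrite rmorphM gK.
Qed.

(** Induction on the number of variables. Without variables every nonzero polynomial is a unit, so
    nothing is irreducible; the step is Gauss' lemma carried through [muni]. *)
Lemma mpoly_irreducible_prime (k : fieldType) (n : nat) (p : {mpoly k[n]}) :
  irreducible_elt p -> prime_elt p.
Proof.
elim: n p => [|n IHn] p.
  case=> p0; rewrite mpoly_unit_msize.
  have pE := nvar0_mpolyC p; rewrite pE in p0 *.
  by rewrite mpolyC_eq0 in p0; rewrite mmeasureC p0.
apply: (irreducible_prime_iso (@muniK k n) (@mmultivK k n)).
exact: irreducible_prime_poly IHn (@mpoly_factors k n).
Qed.

(** * Conjugate polynomials *)

Section MonicMpoly.
Variables (k : fieldType) (n : nat).
Implicit Types p q f g : {mpoly k[n]}.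

Lemma mleadc1_neq0 p : mleadc p = 1 -> p != 0.
Proof. by move=> p1; rewrite -mleadc_eq0 p1 oner_eq0. Qed.

Lemma mleadcMi p q : mleadc (p * q) = mleadc p * mleadc q.
Proof.
have [->|p0] := eqVneq p 0; first by rewrite mul0r mleadc0 mul0r.
have [->|q0] := eqVneq q 0; first by rewrite mulr0 mleadc0 mulr0.
by rewrite mleadM // mleadcM.
Qed.

Lemma mleadc_prodi (I : Type) (s : seq I) (F : I -> {mpoly k[n]}) :
  mleadc (\prod_(i <- s) F i) = \prod_(i <- s) mleadc (F i).
Proof. by apply: (big_morph (fun p => mleadc p) mleadcMi); apply: mleadc1. Qed.

Lemma irreducible_eltZ p (c : k) : c != 0 -> irreducible_elt p -> irreducible_elt (c *: p).
Proof.
move=> c0 [p0 Nup pmul]; split=> [||a b /(congr1 (fun x => c^-1 *: x))].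
- by rewrite mscalerI negb_or c0.
- by move: Nup; rewrite !mpoly_unit_msize msizeZ.
rewrite scalerA mulVf // scale1r scalerAl => /pmul[].
- by rewrite mpoly_unit_msize msizeZ ?invr_eq0 // -mpoly_unit_msize; left.
- by right.
Qed.

Lemma monic_irreducible_factor p : p != 0 -> p \isn't a GRing.unit ->
  exists g, [/\ mleadc g = 1, irreducible_elt g & divides g p].
Proof.
move=> p0 Nup; have [g irr_g [c pE]] := irreducible_factor p0 Nup.
have g0 : mleadc g != 0 by rewrite mleadc_eq0; case: irr_g.
exists ((mleadc g)^-1 *: g); split.
- by rewrite mleadcZE mulVf.
- by apply: irreducible_eltZ => //; rewrite invr_eq0.
- by exists (mleadc g *: c); rewrite -scalerAl -scalerAr scalerA mulfV // scale1r.
Qed.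

Lemma monic_unit p : mleadc p = 1 -> p \is a GRing.unit -> p = 1.
Proof.
rewrite mpoly_unit_msize => p1 /msize_poly1P[c c0 pE].
by move: p1; rewrite pE mleadcC => ->; rewrite mpolyC1.
Qed.

Lemma monic_irreducible_eq p q : mleadc p = 1 -> mleadc q = 1 ->
  irreducible_elt p -> irreducible_elt q -> divides p q -> p = q.
Proof.
move=> p1 q1 [_ Nup _] [_ _ qmul] [c qE].
have c1 : mleadc c = 1 by move: q1; rewrite qE mleadcMi p1 mulr1.
by case: (qmul _ _ qE) => [/(monic_unit c1) cE|]; [rewrite qE cE mul1r | move/(negP Nup)].
Qed.

(** Distinct monic irreducibles are not associated, and they are prime, so their divisibilities
    multiply. *)
Lemma divides_prod (s : seq {mpoly k[n]}) f : uniq s ->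
    {in s, forall g, [/\ mleadc g = 1, irreducible_elt g & divides g f]} ->
  divides (\prod_(g <- s) g) f.
Proof.
elim: s => [|g s IHs] /=; first by exists f; rewrite big_nil mulr1.
case/andP=> g_s uniq_s dvd_s.
have [h fE] : divides (\prod_(g <- s) g) f.
  by apply: IHs => // x xs; apply: dvd_s; rewrite in_cons xs orbT.
have [g1 irr_g] := dvd_s g (mem_head _ _); rewrite fE.
case/(mpoly_irreducible_prime irr_g) => [[c ->]|].
  by exists c; rewrite big_cons mulrA.
have : {in s, forall x, mleadc x = 1 /\ irreducible_elt x}.
  by move=> x xs; case: (dvd_s x) => //; rewrite in_cons xs orbT.
(* It remains to exclude that [g] divides the product of the others: by primality it would equal one
   of them. *)
move=> irr_s g_dvd; exfalso; move: irr_s g_dvd.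
elim: s g_s {IHs uniq_s dvd_s fE} => [|x s IHs] /= g_s irr_s.
  rewrite big_nil => -[c c1]; case: irr_g => _ /negP[].
  by apply/unitrP; exists c; rewrite [g * c]mulrC -c1.
move: g_s; rewrite inE negb_or => /andP[g_x g_s].
rewrite big_cons => /(mpoly_irreducible_prime irr_g)[g_dvd_x|].
  have [x1 irr_x] := irr_s x (mem_head _ _).
  by rewrite (monic_irreducible_eq g1 x1) // eqxx in g_x.
by apply: IHs => // y ys; apply: irr_s; rewrite in_cons ys orbT.
Qed.

Lemma predn_msizeM p q : p != 0 -> q != 0 ->
  (msize (p * q)).-1 = ((msize p).-1 + (msize q).-1)%N.
Proof.
move=> p0 q0; rewrite msizeM // (mpolySpred _ p0) (mpolySpred _ q0).
by rewrite addnS addSn.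
Qed.

End MonicMpoly.

Section Conjugates.
Variables (K : fieldType) (r : nat) (phi : {rmorphism K -> K}).
(** This holds for the Frobenius map of an algebraic closure of a finite field, and makes [Phi]
    bijective. *)
Hypothesis phi_periodic : forall x, exists2 j, (0 < j)%N & iter j phi x = x.
Implicit Types p q f g : {mpoly K[r]}.

Local Notation Phi := (map_mpoly phi : {mpoly K[r]} -> {mpoly K[r]}).

Lemma mcoeff_iter j p m : (iter j Phi p)@_m = iter j phi p@_m.
Proof. by elim: j => //= j <-; rewrite mcoeff_map_mpoly. Qed.

Lemma iter_mul_fix (T : Type) (f : T -> T) i j x : iter j f x = x -> iter (i * j) f x = x.
Proof. by move=> fx; elim: i => // i IHi; rewrite mulSn iterD IHi. Qed.

(** A common multiple of the periods of the finitely many nonzero coefficients is a period of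
    [p]. *)
Lemma Phi_periodic p : exists2 j, (0 < j)%N & iter j Phi p = p.
Proof.
suff [j j0 pj] : exists2 j, (0 < j)%N & {in msupp p, forall m, iter j phi p@_m = p@_m}.
  exists j => //; apply/mpolyP => m; rewrite mcoeff_iter.
  have [/pj //|/memN_msupp_eq0 ->] := boolP (m \in msupp p).
  by elim: j {j0 pj} => //= j ->; rewrite rmorph0.
elim: (msupp p) => [|m s [j j0 IHs]]; first by exists 1%N.
have [i i0 im] := phi_periodic p@_m; exists (i * j)%N; first by rewrite muln_gt0 i0.
move=> x; rewrite inE => /predU1P[->|/IHs]; last exact: iter_mul_fix.
by rewrite mulnC; apply: iter_mul_fix.
Qed.

Lemma Phi_inj : injective Phi.
Proof.
move=> p q /mpolyP pq; apply/mpolyP => m.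
by apply: (fmorph_inj phi); rewrite -!mcoeff_map_mpoly.
Qed.

Lemma Phi_surj p : exists q, Phi q = p.
Proof. by have [[|j] // _ pj] := Phi_periodic p; exists (iter j Phi p). Qed.

Lemma msize_Phi p : msize (Phi p) = msize p.
Proof. by rewrite !msizeE; apply: perm_big; apply: msupp_map_mpoly (fmorph_inj phi). Qed.

Lemma mlead_Phi p : mlead (Phi p) = mlead p.
Proof. by apply: perm_big; apply: msupp_map_mpoly (fmorph_inj phi). Qed.

Lemma mleadc_Phi p : mleadc (Phi p) = phi (mleadc p).
Proof. by rewrite mlead_Phi mcoeff_map_mpoly. Qed.

Lemma monic_Phi p : mleadc p = 1 -> mleadc (Phi p) = 1.
Proof. by rewrite mleadc_Phi => ->; rewrite rmorph1. Qed.

Lemma irreducible_Phi p : irreducible_elt p -> irreducible_elt (Phi p).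
Proof.
case=> p0 Nup pmul; split=> [||a b].
- by rewrite -(raddf0 (map_mpoly phi)) (inj_eq Phi_inj).
- by rewrite mpoly_unit_msize msize_Phi -mpoly_unit_msize.
have [[a' <-] [b' <-]] := (Phi_surj a, Phi_surj b).
rewrite -rmorphM => /Phi_inj/pmul.
by rewrite !mpoly_unit_msize !msize_Phi.
Qed.

Lemma monic_iter i p : mleadc p = 1 -> mleadc (iter i Phi p) = 1.
Proof. by elim: i => //= i IHi /IHi; apply: monic_Phi. Qed.

Lemma irreducible_iter i p : irreducible_elt p -> irreducible_elt (iter i Phi p).
Proof. by elim: i => //= i IHi /IHi; apply: irreducible_Phi. Qed.

Lemma msize_iter i p : msize (iter i Phi p) = msize p.
Proof. by elim: i => //= i <-; rewrite msize_Phi. Qed.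

Lemma iter_Phi_inj i : injective (iter i Phi).
Proof. by elim: i => // i IHi p q /= /Phi_inj/IHi. Qed.

Lemma divides_iter i g f : divides g f -> Phi f = f -> divides (iter i Phi g) f.
Proof.
move=> g_f ff; elim: i => //= i [c fE].
by exists (Phi c); rewrite -rmorphM /= -fE ff.
Qed.

(** The length of the [Phi]-orbit of [g] is [j]; the boolean form allows its use in finite sets. *)
Definition exact_period j g := [&& (0 < j)%N, iter j Phi g == g &
  [forall i : 'I_j, (0 < i)%N ==> (iter i Phi g != g)]].

Lemma exact_periodP g : exists j, exact_period j g.
Proof.
have ex : exists j, (0 < j)%N && (iter j Phi g == g).
  by have [j j0 gj] := Phi_periodic g; exists j; rewrite j0 gj eqxx.
case: (ex_minnP ex) => j /andP[j0 gj] jmin; exists j; rewrite /exact_period j0 gj /=.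
apply/forallP => i; apply/implyP => i0; apply: contraTneq (ltn_ord i) => gi.
by rewrite -leqNgt jmin // i0 gi eqxx.
Qed.

Lemma exact_period_dvd i j g : exact_period j g -> iter i Phi g = g -> (j %| i)%N.
Proof.
case/and3P=> j0 /eqP gj /forallP gmin.
rewrite {1}(divn_eq i j) addnC iterD iter_mul_fix // => gi.
have := gmin (Ordinal (ltn_pmod i j0)); rewrite /= gi eqxx implybF.
by rewrite -eqn0Ngt.
Qed.

Lemma exact_period_uniq j g : exact_period j g -> uniq (traject Phi g j).
Proof.
case/and3P=> j0 /eqP gj /forallP gmin.
apply/(uniqP g) => i0 i0'; move: i0 i0'; rewrite size_traject.
suff lt_neq i i' : (i < i' < j)%N -> iter i Phi g <> iter i' Phi g.
  move=> i i'; rewrite !inE => ij i'j; rewrite !nth_traject // => E.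
  case: (ltngtP i i') => // [lt|lt].
  - by case: (lt_neq i i'); rewrite ?lt.
  - by case: (lt_neq i' i); rewrite ?lt.
case/andP=> lt_ii' lt_i'j.
rewrite -{1}(subnKC (ltnW lt_ii')) iterD => /iter_Phi_inj/esym/eqP.
have lt_d : (i' - i < j)%N by lia.
by have := gmin (Ordinal lt_d); rewrite /= subn_gt0 lt_ii' /= => /negP.
Qed.

(** For [g] of exact period [j] this is the product of the distinct conjugates of [g], the analogue
    of a field norm. *)
Definition norm j g : {mpoly K[r]} := \prod_(h <- traject Phi g j) h.

Lemma Phi_norm j g : Phi (norm j g) = norm j (Phi g).
Proof.
have map_traject : map Phi (traject Phi g j) = traject Phi (Phi g) j.
  by elim: j g => //= i IHi p; rewrite IHi.
by rewrite /norm -map_traject big_map rmorph_prod.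
Qed.

Lemma norm_fixed j g : iter j Phi g = g -> Phi (norm j g) = norm j g.
Proof.
rewrite Phi_norm /norm; case: j => [|j] gj; first by rewrite !big_nil.
rewrite [in RHS]trajectS trajectSr -cats1 big_cat /= !big_cons big_nil mulr1.
by rewrite -iterSr gj mulrC.
Qed.

Lemma monic_norm j g : mleadc g = 1 -> mleadc (norm j g) = 1.
Proof.
move=> g1; rewrite /norm mleadc_prodi big_seq big1 // => h /trajectP[i _ ->].
exact: monic_iter.
Qed.

Lemma msize_norm j g : mleadc g = 1 -> msize (norm j g) = (j * (msize g).-1).+1.
Proof.
move=> g1; rewrite (mpolySpred _ (mleadc1_neq0 (monic_norm j g1))); congr _.+1.
rewrite /norm; elim: j g g1 => [|j IHj] g g1; first by rewrite big_nil msize1.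
rewrite trajectS big_cons predn_msizeM ?(mleadc1_neq0 g1) ?IHj ?msize_Phi //.
- exact: monic_Phi.
- by apply: mleadc1_neq0; apply: (monic_norm j (monic_Phi g1)).
Qed.

Lemma divides_norm j g : (0 < j)%N -> divides g (norm j g).
Proof.
by case: j => // j _; exists (norm j (Phi g)); rewrite /norm trajectS big_cons mulrC.
Qed.

(** As [f] is fixed by [Phi], all conjugates of [g] divide it; they are distinct monic irreducibles,
    so their product divides it too. *)
Lemma norm_divides j g f : mleadc g = 1 -> irreducible_elt g -> exact_period j g ->
  divides g f -> Phi f = f -> divides (norm j g) f.
Proof.
move=> g1 irr_g per_g g_f ff; apply: divides_prod; first exact: exact_period_uniq.
move=> h /trajectP[i _ ->]; split; first exact: monic_iter.
- exact: irreducible_iter.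
- exact: divides_iter.
Qed.

Lemma irreducible_divides_norm j g h : mleadc g = 1 -> irreducible_elt g ->
  mleadc h = 1 -> irreducible_elt h -> divides h (norm j g) ->
  h \in traject Phi g j.
Proof.
move=> g1 irr_g h1 irr_h; rewrite /norm.
elim: j g g1 irr_g => [|j IHj] g g1 irr_g.
  rewrite big_nil => -[c c1]; case: irr_h => _ /negP[].
  by apply/unitrP; exists c; rewrite [h * c]mulrC -c1.
rewrite trajectS big_cons inE => /(mpoly_irreducible_prime irr_h)[h_g|].
  by rewrite (monic_irreducible_eq h1 g1) ?eqxx.
by move/IHj->; rewrite ?orbT //; [apply: monic_Phi | apply: irreducible_Phi].
Qed.

Lemma iter_Phi_fix i g : Phi g = g -> iter i Phi g = g.
Proof. by move=> gg; elim: i => //= i ->. Qed.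

Lemma norm_iter i j g : iter j Phi g = g -> norm j (iter i Phi g) = norm j g.
Proof.
move=> gj; elim: i => //= i IHi.
by rewrite -Phi_norm IHi norm_fixed.
Qed.

Lemma exact_period_iter i j g : exact_period j g -> exact_period j (iter i Phi g).
Proof.
case/and3P=> j0 /eqP gj /forallP gmin; rewrite /exact_period j0 -iterD addnC iterD gj eqxx /=.
apply/forallP => l; have := gmin l; rewrite -iterD addnC iterD.
by rewrite (inj_eq (@iter_Phi_inj i)).
Qed.

End Conjugates.

(** * Counting polynomials over finite sets of coefficients *)

Section FsetCardinality.
Local Open Scope fset_scope.

Lemma leq_card_bigfcup (I : Type) (T : choiceType) (s : seq I) (P : pred I)
    (A : I -> {fset T}) :
  (#|` \bigcup_(i <- s | P i) A i| <= \sum_(i <- s | P i) #|` A i|)%N.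
Proof.
elim/big_rec2: _ => [|i x B Pi le_Bx]; first by rewrite cardfs0.
by rewrite (leq_trans _ (leq_add (leqnn _) le_Bx)) // cardfsU leq_subr.
Qed.

Lemma leq_card_imset (T U : choiceType) (f : T -> U) (A : {fset T}) :
  (#|` f @` A| <= #|` A|)%N.
Proof. exact: leq_imfset_card. Qed.

Lemma leq_card_fsetM (T U : choiceType) (A : {fset T}) (B : {fset U}) :
  (#|` A `*` B| <= #|` A| * #|` B|)%N.
Proof.
have -> : A `*` B = \bigcup_(x <- A) [fset (x, y) | y in B].
  apply/fsetP => -[x y]; rewrite in_fsetM /=; apply/andP/bigfcupP.
  - case=> xA yB; exists x; first by rewrite xA.
    by apply/imfsetP; exists y.
  - by case=> x' /andP[x'A _] /imfsetP[y' /= y'B [-> ->]].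
apply: leq_trans (leq_card_bigfcup _ _ _) _.
apply: (@leq_trans (\sum_(x <- A) #|` B|)).
  by apply: leq_sum => x _; apply: leq_card_imset.
by rewrite big_const_seq count_predT iter_addn_0 mulnC.
Qed.

Lemma card_fibers (T U : choiceType) (f : T -> U) (A : {fset T}) (n : nat) :
    {in A, forall x, #|` [fset y in A | f y == f x]| = n} ->
  #|` A| = (#|` f @` A| * n)%N.
Proof.
move=> fib; rewrite -sum1_size (partition_big_imfset _ f) /=.
rewrite big_seq (eq_bigr (fun=> n)).
  by rewrite -big_seq big_const_seq count_predT iter_addn_0 mulnC.
move=> _ /imfsetP[x /= xA ->]; rewrite -(fib x xA).
rewrite -sum1_size [in RHS]big_fset /=; apply: eq_bigl => y.
by rewrite /=.
Qed.

Lemma sum_bin_diag (n d : nat) : (\sum_(e < d.+1) 'C(n + e, n))%N = 'C(n.+1 + d, n.+1).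
Proof.
elim: d => [|d IHd]; first by rewrite big_ord1 !addn0 !binn.
by rewrite big_ord_recr /= IHd [(n.+1 + d.+1)%N]addSn binS addSnnS.
Qed.

(** The monomials are sorted by exact degree [e], and the class sizes add up by the hockey-stick
    identity. *)
Lemma card_bmultinom (n d : nat) : #|{: 'X_{1..n.+1 < d.+1}}| = 'C(n.+1 + d, n.+1).
Proof.
have card_deg (e : 'I_d.+1) :
    #|[pred m : 'X_{1..n.+1 < d.+1} | mdeg m == e]| = 'C(n + e, n).
  rewrite -[RHS]bin_sub ?leq_addr // addKn addnC -size_basis cardE -(size_map val).
  apply: perm_size; apply: uniq_perm; rewrite ?uniq_basis //.
    by rewrite (map_inj_uniq val_inj) enum_uniq.
  move=> m; rewrite -basis_cover; apply/mapP/eqP => [[m' /[!mem_enum]]|mE].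
    by rewrite inE => /eqP <- ->.
  have lt_m : (mdeg m < d.+1)%N by rewrite mE.
  by exists (BMultinom lt_m); rewrite // mem_enum inE /= mE.
pose deg (m : 'X_{1..n.+1 < d.+1}) : 'I_d.+1 := inord (mdeg m).
rewrite -sum1_card (partition_big deg predT) //=.
rewrite (eq_bigr (fun e : 'I_d.+1 => 'C(n + e, n))).
  exact: sum_bin_diag.
move=> e _; rewrite -(card_deg e) -sum1_card; apply: eq_bigl => m.
by rewrite inE -val_eqE /= inordK // bmdeg.
Qed.

End FsetCardinality.

Section FiniteCoefficients.
Local Open Scope fset_scope.
(** [S] plays the part of a finite subfield of [K]. *)
Variables (K : fieldType) (r : nat) (S : {fset K}).
Hypothesis S0 : 0 \in S.
Hypotheses (SM : {in S &, forall x y, x * y \in S}).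
Hypotheses (SV : {in S, forall x, x^-1 \in S}).

Definition mpoly_of_ffun D (h : {ffun 'X_{1..r < D} -> S}) : {mpoly K[r]} :=
  \sum_(m : 'X_{1..r < D}) val (h m) *: 'X_[m].

Lemma mcoeff_mpoly_of_ffun D (h : {ffun 'X_{1..r < D} -> S}) (m : 'X_{1..r < D}) :
  (mpoly_of_ffun h)@_m = val (h m).
Proof.
rewrite raddf_sum (bigD1 m) //= big1 => [|m' neq_m'].
  by rewrite addr0 mcoeffZ mcoeffX eqxx mulr1.
by rewrite mcoeffZ mcoeffX -bmeqP (negbTE neq_m') mulr0.
Qed.

Lemma mcoeff_mpoly_of_ffun_ge D (h : {ffun 'X_{1..r < D} -> S}) m :
  (D <= mdeg m)%N -> (mpoly_of_ffun h)@_m = 0.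
Proof.
move=> le_D; rewrite raddf_sum big1 //= => m' _; rewrite mcoeffZ mcoeffX.
by case: eqP => [E|]; rewrite ?mulr0 //; have := bmdeg m'; rewrite E ltnNge le_D.
Qed.

Definition fmpoly D : {fset {mpoly K[r]}} :=
  [fset mpoly_of_ffun h | h in {: {ffun 'X_{1..r < D} -> S}}].

Lemma fmpolyP D p :
  reflect ((msize p <= D)%N /\ forall m, p@_m \in S) (p \in fmpoly D).
Proof.
apply: (iffP (imfsetP _ _ _ _)) => /= [[h _ ->]|[le_pD pS]].
  split=> [|m].
    rewrite msizeE; apply/bigmax_leqP_seq => m; rewrite mcoeff_msupp => hm _.
    by rewrite ltnNge; apply: contraNN hm => /mcoeff_mpoly_of_ffun_ge ->.
  have [/mcoeff_mpoly_of_ffun_ge -> //|lt_m] := leqP D (mdeg m).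
  by rewrite -[m]/(val (BMultinom lt_m)) mcoeff_mpoly_of_ffun; apply: fsvalP.
exists [ffun m : 'X_{1..r < D} => [` pS m]] => //; apply/mpolyP => m.
have [le_m|lt_m] := leqP D (mdeg m).
  rewrite mcoeff_mpoly_of_ffun_ge //; apply: memN_msupp_eq0.
  by apply: msize_mdeg_ge; apply: leq_trans le_m.
by rewrite -[m]/(val (BMultinom lt_m)) mcoeff_mpoly_of_ffun ffunE.
Qed.

Lemma card_fmpoly D : #|` fmpoly D| = (#|` S| ^ #|{: 'X_{1..r < D}}|)%N.
Proof.
rewrite card_imfset /=.
  by rewrite -cardE card_ffun cardfE.
move=> h h' /mpolyP E; apply/ffunP => m; apply: val_inj.
by rewrite -!mcoeff_mpoly_of_ffun E.
Qed.

Definition monics d : {fset {mpoly K[r]}} :=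
  [fset p in fmpoly d.+1 | (mleadc p == 1) && (msize p == d.+1)].

Lemma monicsP d p : reflect
  [/\ mleadc p = 1, msize p = d.+1 & forall m, p@_m \in S] (p \in monics d).
Proof.
rewrite !inE /=; apply: (iffP and3P) => [[/fmpolyP[_ pS] /eqP p1 /eqP sp] //|[p1 sp pS]].
by rewrite p1 sp !eqxx; split=> //; apply/fmpolyP; rewrite sp.
Qed.

(** Dividing by the leading coefficient maps the polynomials of exact degree [d] onto the monic
    ones, with fibres in bijection with the nonzero elements of [S]. The form avoids division and
    subtraction of the two totals. *)
Lemma card_monics d : (#|` monics d| * (#|` S| - 1) + #|` fmpoly d|)%N = #|` fmpoly d.+1|.
Proof.
have sub : fmpoly d `<=` fmpoly d.+1.
  by apply/fsubsetP => p /fmpolyP[le_p pS]; apply/fmpolyP; rewrite ltnW.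
rewrite -(cardfsID (fmpoly d) (fmpoly d.+1)) (fsetIidPr sub) addnC; congr addn.
set A := _ `\` _.
pose f (p : {mpoly K[r]}) := (mleadc p)^-1 *: p.
have AP p : reflect (msize p = d.+1 /\ forall m, p@_m \in S) (p \in A).
  rewrite in_fsetD; apply: (iffP andP) => [[/fmpolyP Np /fmpolyP[le_p pS]]|[sp pS]].
    split=> //; apply/eqP; rewrite eqn_leq le_p ltnNge; apply/negP => le_pd.
    by apply: Np.
  by split; [apply/fmpolyP => -[]; rewrite sp ltnn | apply/fmpolyP; rewrite sp].
clearbody A.
have szf (c : K) (p : {mpoly K[r]}) : c != 0 -> msize (c *: p) = msize p := @msizeZ _ _ c p.
have A0 p : p \in A -> p != 0.
  by case/AP => sp _; rewrite -msize_poly_eq0 sp.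
have fA : f @` A = monics d.
  apply/fsetP => p; apply/imfsetP/monicsP => [[g /= gA ->]|[p1 sp pS]].
    have g0 := A0 g gA; have [sg gS] := AP _ gA; rewrite /f mleadcZE mulVf ?mleadc_eq0 //.
    split=> // [|m]; first by rewrite szf // invr_eq0 mleadc_eq0.
    by rewrite mcoeffZ SM // SV.
  by exists p; [apply/AP | rewrite /f p1 invr1 scale1r].
rewrite -fA; apply/esym/card_fibers => p pA.
have p0 := A0 p pA; have [sp pS] := AP _ pA.
have -> : [fset y in A | f y == f p] = [fset c *: f p | c in S `\ 0].
  apply/fsetP => q; rewrite !inE /=; apply/andP/imfsetP => [[qA /eqP fqp]|[c /=]].
    exists (mleadc q); rewrite /= ?inE ?mleadc_eq0 ?A0 //.
      by have [_ qS] := AP _ qA; rewrite qS.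
    by rewrite -fqp /f scalerA divff ?scale1r // mleadc_eq0 A0.
  rewrite !inE => /andP[c0 cS] ->; split.
    have lp : (mleadc p)^-1 != 0 by rewrite invr_eq0 mleadc_eq0.
    apply/AP; rewrite /f !szf //; split=> // m.
    by rewrite !mcoeffZ SM ?SM ?SV.
  rewrite /f !mleadcZE mulVf ?mleadc_eq0 // mulr1 scalerA mulVf // scale1r.
  by rewrite eqxx.
rewrite card_imfset /=; last first.
  move=> c c' /(congr1 (fun p => mleadc p)); rewrite /f !mleadcZE.
  by rewrite mulVf ?mleadc_eq0 // !mulr1.
by rewrite (cardfsD1 0 S) S0 /= addKn.
Qed.

End FiniteCoefficients.

(** * Frobenius maps *)

Lemma frobenius_exists (K : fieldType) (q : nat) : [pchar K].-nat q ->
  exists phi : {rmorphism K -> K}, forall x, phi x = x ^+ q.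
Proof.
move=> Kq; pose f (x : K) := x ^+ q.
have fB : zmod_morphism f.
  by move=> x y; rewrite /f exprDn_pchar // exprNn_pchar.
have fM : monoid_morphism f.
  by split=> [|x y]; rewrite /f ?expr1n ?exprMn.
pose fBm := GRing.isZmodMorphism.Build K K f fB.
pose fMm := GRing.isMonoidMorphism.Build K K f fM.
pose phi : {rmorphism K -> K} := HB.pack f fBm fMm.
by exists phi.
Qed.

Lemma iter_expr (K : fieldType) (phi : K -> K) (q j : nat) (x : K) :
  (forall x, phi x = x ^+ q) -> iter j phi x = x ^+ (q ^ j).
Proof.
by move=> phiE; elim: j => [|j IHj]; rewrite ?expr1 //= phiE IHj -exprM expnSr.
Qed.

(** The iterates of [x] under [phi] are all roots of one nonzero polynomial over [F], so two of them
    coincide; injectivity of [phi] cancels the common initial iterates. *)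
Lemma frobenius_periodic (F K : fieldType) (iota : {rmorphism F -> K})
    (phi : {rmorphism K -> K}) : integralRange iota ->
    (forall c, phi (iota c) = iota c) ->
  forall x, exists2 j, (0 < j)%N & iter j phi x = x.
Proof.
move=> algK frob_iota x; have [p mon_p root_p] := algK x.
pose P := map_poly iota p.
have P0 : P != 0 by rewrite map_poly_eq0 monic_neq0.
have root_iter i : root P (iter i phi x).
  elim: i => //= i /(rmorph_root phi); rewrite /P -map_poly_comp.
  by rewrite (eq_map_poly (g := iota)) // => c /=; rewrite frob_iota.
have : ~~ uniq (traject phi x (size P).-1.+1).
  apply/negP => uniq_t.
  have: all (root P) (traject phi x (size P).-1.+1).
    by apply/allP => _ /trajectP[i _ ->].
  move=> /(max_poly_roots P0)/(_ uniq_t); rewrite size_traject prednK ?ltnn //.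
  by rewrite size_poly_gt0.
rewrite looping_uniq negbK => /trajectP[i lt_i E].
exists ((size P).-1 - i)%N; first by rewrite subn_gt0.
have inj_iter m : injective (iter m phi).
  by elim: m => // m IHm y z /= /(fmorph_inj phi)/IHm.
by apply: (inj_iter i); rewrite -iterD subnKC 1?ltnW.
Qed.

Section PowFixed.
Local Open Scope fset_scope.

(** The polynomial ['X^Q - 'X] has derivative [-1], hence is separable and has [Q] distinct
    roots. *)
Lemma pow_fixed_exists (K : closedFieldType) (Q : nat) : (1 < Q)%N -> Q%:R = 0 :> K ->
  exists S : {fset K}, (forall x, (x \in S) = (x ^+ Q == x)) /\ #|` S| = Q.
Proof.
move=> Q1 Q0; pose P : {poly K} := 'X^Q - 'X.
have sizeP : size P = Q.+1 by rewrite size_polyDl size_polyXn // size_polyN size_polyX.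
have lP : lead_coef P = 1.
  by rewrite lead_coefDl ?lead_coefXn // size_polyXn size_polyN size_polyX.
have [s] := closed_field_poly_normal P; rewrite lP scale1r => PE.
have uniq_s : uniq s.
  rewrite -separable_prod_XsubC -PE separable_poly.unlock.
  rewrite derivB derivXn derivX -scaler_nat Q0 scale0r sub0r.
  by rewrite -scaleN1r coprimepZr ?oppr_eq0 ?oner_eq0 // coprimep1.
exists [fset x in s]; split=> [x|].
  by rewrite inE /= -root_prod_XsubC -PE rootE !hornerE subr_eq0.
rewrite card_fseq undup_id //; apply: succn_inj.
by rewrite -sizeP PE size_prod_XsubC.
Qed.

(* Junk value [fset0] when no such set exists. *)
Definition pow_fixed (K : closedFieldType) (Q : nat) : {fset K} :=
  xget fset0 [set S : {fset K} | forall x, (x \in S) = (x ^+ Q == x)]%classic.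

Variables (K : closedFieldType) (Q : nat).
Hypotheses (Q_gt1 : (1 < Q)%N) (Q0 : Q%:R = 0 :> K).

Lemma mem_pow_fixed x : (x \in pow_fixed K Q) = (x ^+ Q == x).
Proof.
have [S [SP _]] := pow_fixed_exists Q_gt1 Q0.
by rewrite /pow_fixed; case: xgetP => [_ -> ->|/(_ S)].
Qed.

Lemma card_pow_fixed : #|` pow_fixed K Q| = Q.
Proof.
have [S [SP cS]] := pow_fixed_exists Q_gt1 Q0; rewrite -[RHS]cS; congr #|` _|.
by apply/fsetP => x; rewrite mem_pow_fixed SP.
Qed.

Lemma pow_fixed0 : 0 \in pow_fixed K Q.
Proof. by rewrite mem_pow_fixed expr0n; case: Q Q_gt1. Qed.

Lemma pow_fixedM : {in pow_fixed K Q &, forall x y, x * y \in pow_fixed K Q}.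
Proof. by move=> x y; rewrite !mem_pow_fixed exprMn => /eqP-> /eqP->. Qed.

Lemma pow_fixedV : {in pow_fixed K Q, forall x, x^-1 \in pow_fixed K Q}.
Proof. by move=> x; rewrite !mem_pow_fixed exprVn => /eqP->. Qed.

End PowFixed.

Lemma pchar_card_finField (F : finFieldType) (K : fieldType)
  (iota : {rmorphism F -> K}) : [pchar K].-nat #|F|.
Proof.
have [p pr_p charFp] := finPcharP F.
have : p.-nat #|F|.
  rewrite -cardsT; exact: abelem_pgroup (fin_ring_pchar_abelem charFp).
apply: sub_in_pnat => l _; rewrite !inE => /eqP ->.
by have := charFp; rewrite -(fmorph_pchar iota).
Qed.

(** * Orbits of absolutely irreducible polynomials *)

Section AbsolutelyIrreducible.
Local Open Scope fset_scope.

Definition fmonics (K : closedFieldType) (r Q d : nat) : {fset {mpoly K[r]}} :=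
  monics r (pow_fixed K Q) d.

Lemma fmonicsP (K : closedFieldType) (r Q d : nat) (p : {mpoly K[r]}) :
    (1 < Q)%N -> Q%:R = 0 :> K -> reflect
  [/\ mleadc p = 1, msize p = d.+1 & forall m, p@_m ^+ Q = p@_m] (p \in fmonics K r Q d).
Proof.
move=> Q1 Q0; apply: (iffP (monicsP (pow_fixed0 Q1 Q0) _ _)) => -[p1 sp pQ]; split=> // m.
  by have := pQ m; rewrite mem_pow_fixed // => /eqP.
by rewrite mem_pow_fixed // pQ.
Qed.

Lemma card_fmonics (K : closedFieldType) (r Q d : nat) :
    (1 < Q)%N -> Q%:R = 0 :> K ->
  (#|` fmonics K r.+1 Q d.+1| * (Q - 1) + Q ^ 'C(r.+1 + d, r.+1) =
   Q ^ 'C(r.+1 + d.+1, r.+1))%N.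
Proof.
move=> Q1 Q0; rewrite -!card_bmultinom -{2 3 4}(card_pow_fixed Q1 Q0) -!card_fmpoly.
apply: card_monics; [exact: pow_fixed0 | exact: pow_fixedM | exact: pow_fixedV].
Qed.

Variables (K : closedFieldType) (r q : nat) (phi : {rmorphism K -> K}).
Hypotheses (q_gt1 : (1 < q)%N) (q0 : q%:R = 0 :> K).
Hypothesis phiE : forall x, phi x = x ^+ q.
Hypothesis phi_periodic : forall x, exists2 j, (0 < j)%N & iter j phi x = x.
Implicit Types (f g h : {mpoly K[r]}) (j d n : nat).

Local Notation Phi := (map_mpoly phi : {mpoly K[r]} -> {mpoly K[r]}).

Lemma qX_gt1 j : (0 < j)%N -> (1 < q ^ j)%N.
Proof. by move=> j0; rewrite -[X in (X < _)%N](exp1n j) ltn_exp2r. Qed.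

Lemma qX0 j : (0 < j)%N -> (q ^ j)%:R = 0 :> K.
Proof. by case: j => // j _; rewrite expnS natrM q0 mul0r. Qed.

Lemma iter_Phi_eq j g : iter j Phi g = g <-> forall m, g@_m ^+ (q ^ j) = g@_m.
Proof.
split=> [gj m|gj].
  by rewrite -(iter_expr _ _ phiE) -mcoeff_iter gj.
by apply/mpolyP => m; rewrite mcoeff_iter (iter_expr _ _ phiE).
Qed.

Lemma fmonics_iterP j d g : (0 < j)%N -> reflect
  [/\ mleadc g = 1, msize g = d.+1 & iter j Phi g = g] (g \in fmonics K r (q ^ j) d).
Proof.
move=> j0; apply: (iffP (fmonicsP _ _ (qX_gt1 j0) (qX0 j0))) => -[g1 sg gj]; split=> //.
  exact/iter_Phi_eq.
exact/iter_Phi_eq.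
Qed.

Lemma fmonics_fixedP d g : reflect
  [/\ mleadc g = 1, msize g = d.+1 & Phi g = g] (g \in fmonics K r q d).
Proof. exact: (@fmonics_iterP 1 d g isT). Qed.

(** Since [K] is algebraically closed, irreducibility over [K] is absolute irreducibility. *)
Definition abs_irr j d : {fset {mpoly K[r]}} :=
  [fset g in fmonics K r (q ^ j) d | exact_period phi j g && `[< irreducible_elt g >]].

Lemma abs_irrP j d g : reflect
  [/\ mleadc g = 1, msize g = d.+1, exact_period phi j g & irreducible_elt g]
  (g \in abs_irr j d).
Proof.
rewrite inE /=; apply: (iffP and3P) => [[gP per_g /asboolP irr_g]|[g1 sg per_g irr_g]].
  by have /and3P[j0 _ _] := per_g; have /(fmonics_iterP _ _ j0)[] := gP.
split=> //; last exact/asboolP.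
by have /and3P[j0 /eqP gj _] := per_g; apply/fmonics_iterP.
Qed.

(* The elements of [rel_irr n] are the images in [K] of the relatively irreducible
   polynomials over the subfield fixed by [phi], for [n > 0]; but [1 \in rel_irr 0]. *)
Definition rel_irr n : {fset {mpoly K[r]}} :=
  [fset f in fmonics K r q n |
     `[< forall a b, Phi a = a -> Phi b = b -> f = a * b ->
           a \is a GRing.unit \/ b \is a GRing.unit >]
     && ~~ `[< irreducible_elt f >]].

Lemma rel_irrP n f : reflect
  [/\ mleadc f = 1, msize f = n.+1, Phi f = f,
      forall a b, Phi a = a -> Phi b = b -> f = a * b ->
        a \is a GRing.unit \/ b \is a GRing.unit
    & ~ irreducible_elt f]
  (f \in rel_irr n).
Proof.
rewrite inE /=; apply: (iffP and3P) => [[/fmonics_fixedP[]]|[f1 sf ff fmul Nirr]].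
  by move=> f1 sf ff /asboolP fmul /asboolP.
by split; [apply/fmonics_fixedP | apply/asboolP | apply/asboolP].
Qed.

(** Take a monic factor [g] of [f] irreducible over [K]: its norm divides [f], and the cofactor is
    fixed because [f] and the norm are. *)
Lemma fixed_factor f n : mleadc f = 1 -> msize f = n.+1 -> (0 < n)%N -> Phi f = f ->
  exists j g b, [/\ g \in abs_irr j (msize g).-1, (1 < msize g)%N,
    f = norm phi j g * b & mleadc b = 1 /\ Phi b = b].
Proof.
move=> f1 sf n0 ff.
have Nuf : f \isn't a GRing.unit by rewrite mpoly_unit_msize sf eqSS -lt0n.
have [g [g1 irr_g g_f]] := monic_irreducible_factor (mleadc1_neq0 f1) Nuf.
have [j per_g] := exact_periodP phi_periodic g.
have [b fE] := norm_divides phi_periodic g1 irr_g per_g g_f ff.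
have N1 := monic_norm phi j g1.
have [g0 Nug _] := irr_g; have sg := msize_nonunit g0 Nug.
exists j, g, b; split=> //; last split.
- by apply/abs_irrP; split=> //; rewrite prednK // ltnW.
- by rewrite mulrC.
- by move: f1; rewrite fE mleadcMi N1 mulr1.
- have fN : Phi (norm phi j g) = norm phi j g.
    by apply: norm_fixed; have /and3P[_ /eqP] := per_g.
  apply: (mulIf (mleadc1_neq0 N1)); rewrite -fE -[RHS]ff [in RHS]fE rmorphM /=.
  by rewrite fN.
Qed.

(** The orbit length divides the prime [l], so it is [l] or [1]. *)
Lemma irreducible_prime_period l d : prime l ->
  [fset f in fmonics K r (q ^ l) d | `[< irreducible_elt f >]]
    `<=` abs_irr l d `|` fmonics K r q d.
Proof.
move=> pr_l; have l0 := prime_gt0 pr_l; apply/fsubsetP => f.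
rewrite in_fset unfold_in => /andP[/= /(fmonics_iterP _ _ l0)[f1 sf fl] /asboolP irr_f].
have [j per_f] := exact_periodP phi_periodic f.
rewrite in_fsetU; apply/orP.
have /(prime_nt_dvdP pr_l) := exact_period_dvd per_f fl.
have [jE _|j1 /(_ isT) jE] := eqVneq j 1%N.
  by right; apply/fmonics_fixedP; split=> //; move: per_f; rewrite jE => /and3P[_ /eqP].
by left; apply/abs_irrP; rewrite -jE.
Qed.

(** By unique factorization, the polynomials with the same norm as [g] are exactly the [j]
    conjugates of [g]. *)
Lemma card_norm_abs_irr j d :
  #|` abs_irr j d| = (#|` norm phi j @` abs_irr j d| * j)%N.
Proof.
apply: card_fibers => g gA; have /abs_irrP[g1 sg per_g irr_g] := gA.
have uniq_g := exact_period_uniq per_g.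
have /and3P[j0 /eqP gj _] := per_g.
have -> : [fset y in abs_irr j d | norm phi j y == norm phi j g] =
          [fset h in traject Phi g j].
  apply/fsetP => h; rewrite !in_fset /= [LHS]unfold_in.
  apply/andP/idP => [[/abs_irrP[h1 sh per_h irr_h] /eqP Nh]|/trajectP[i _ ->]].
    apply: irreducible_divides_norm => //; rewrite -Nh; exact: divides_norm.
  rewrite norm_iter // eqxx; split=> //; apply/abs_irrP; split.
  - exact: monic_iter.
  - by rewrite msize_iter.
  - exact: exact_period_iter.
  - exact: irreducible_iter.
by rewrite card_fseq undup_id // size_traject.
Qed.

(** If the norm splits into fixed factors, the factor divisible by [g] is divisible by the whole
    norm, so the other is a unit. Over [K], the factor [g] is proper because [j > 1]. *)
Lemma norm_rel_irr j d : (1 < j)%N -> (0 < d)%N ->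
  norm phi j @` abs_irr j d `<=` rel_irr (j * d).
Proof.
move=> j1 d0; apply/fsubsetP => _ /imfsetP[g /= /abs_irrP[g1 sg per_g irr_g] ->].
have /and3P[j0 /eqP gj _] := per_g.
have N1 := monic_norm phi j g1.
have sN := msize_norm phi j g1; rewrite sg /= in sN.
have Nfix := norm_fixed gj.
have dvdN (a b : {mpoly K[r]}) : Phi a = a -> norm phi j g = a * b -> divides g a ->
    b \is a GRing.unit.
  move=> aa NE g_a; have [c aE] := norm_divides phi_periodic g1 irr_g per_g g_a aa.
  apply/unitrP; exists c; suff cb : c * b = 1 by rewrite [b * c]mulrC.
  apply: (mulfI (mleadc1_neq0 N1)); rewrite mulr1 [in RHS]NE aE; ring.
apply/rel_irrP; split=> // [a b aa bb NE|[_ _ Nmul]].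
  have := divides_norm phi g j0; rewrite NE.
  case/(mpoly_irreducible_prime irr_g) => [g_a|g_b].
    by right; apply: dvdN NE g_a.
  by left; apply: (dvdN b a) => //; rewrite mulrC.
have [b NE] := divides_norm phi g j0.
have [_ Nug _] := irr_g.
case: (Nmul _ _ NE) => [ub|]; last by rewrite (negbTE Nug).
have := sN; rewrite NE msizeM ?(mleadc1_neq0 g1) //; last first.
  by apply: contraTneq ub => ->; rewrite unitr0.
move: ub; rewrite mpoly_unit_msize => /eqP ->; rewrite sg /=.
by nia.
Qed.

(** Irreducibility over the fixed field forces the cofactor in [fixed_factor] to be [1]; [j = 1]
    would make [f] irreducible over [K]. *)
Lemma rel_irr_norm n f : (0 < n)%N -> f \in rel_irr n ->
  exists2 j, (1 < j)%N && (j %| n)%N & f \in norm phi j @` abs_irr j (n %/ j).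
Proof.
move=> n0 /rel_irrP[f1 sf ff fmul Nirr].
have [j [g [b [gA sg fE [b1 bb]]]]] := fixed_factor f1 sf n0 ff.
have /abs_irrP[g1 _ per_g irr_g] := gA.
have /and3P[j0 /eqP gj _] := per_g.
have b_1 : b = 1.
  apply: monic_unit => //; case: (fmul _ _ (norm_fixed gj) bb fE) => // uN.
  exfalso; move: uN; rewrite mpoly_unit_msize msize_norm // eqSS muln_eq0 (gtn_eqF j0) /=.
  by case: (msize g) sg => [|[]].
rewrite b_1 mulr1 in fE.
have nE : n = (j * (msize g).-1)%N.
  by apply: succn_inj; rewrite -sf fE msize_norm.
exists j; last first.
  by apply/imfsetP; exists g; rewrite //= nE mulKn.
rewrite nE dvdn_mulr // andbT; rewrite ltn_neqAle j0 andbT; apply/eqP => j1; case: Nirr.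
by rewrite fE -j1 /norm /= big_seq1.
Qed.

Lemma card_rel_irr_ge j d : (1 < j)%N -> (0 < d)%N ->
  (#|` abs_irr j d| <= #|` rel_irr (j * d)| * j)%N.
Proof.
move=> j1 d0; rewrite card_norm_abs_irr leq_mul2r.
by rewrite fsubset_leq_card ?orbT //; apply: norm_rel_irr.
Qed.

Lemma card_rel_irr_le n : (0 < n)%N ->
  (#|` rel_irr n| <= \sum_(1 <= d < n | (d %| n)%N)
     #|` norm phi (n %/ d) @` abs_irr (n %/ d) d|)%N.
Proof.
move=> n0; apply: leq_trans (leq_card_bigfcup _ _ _); apply: fsubset_leq_card.
apply/fsubsetP => f /(rel_irr_norm n0)[j /andP[j1 /dvdnP[d nE]] fN].
have j0 : (0 < j)%N by apply: ltnW.
have d0 : (0 < d)%N by move: n0; rewrite nE muln_gt0 => /andP[].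
apply/bigfcupP; exists d; last by move: fN; rewrite nE mulnK // mulKn.
by rewrite mem_index_iota d0 nE -[X in (X < _)%N]muln1 ltn_mul2l d0 j1 dvdn_mulr.
Qed.

Lemma rel_irr1 : rel_irr 1 = fset0.
Proof.
apply/fsetP => f; rewrite in_fset0; apply/negP => /(rel_irr_norm (ltn0Sn 0)).
by case=> j /andP[j1]; rewrite dvdn1 => /eqP jE; rewrite jE in j1.
Qed.

(** A fixed [f] that is not irreducible over [K] is the norm of an irreducible factor times a fixed
    cofactor. Either the cofactor is [1], or [f] is a product of two fixed polynomials of positive
    degree. This bounds the absolutely irreducible polynomials from below. *)
Lemma fmonics_cover n : (0 < n)%N ->
  fmonics K r q n `<=` [fset f in fmonics K r q n | `[< irreducible_elt f >]]
    `|` \bigcup_(i <- index_iota 1 n)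
          (fun ab => ab.1 * ab.2) @` (fmonics K r q i `*` fmonics K r q (n - i))
    `|` \bigcup_(d <- index_iota 1 n | (d %| n)%N)
          norm phi (n %/ d) @` fmonics K r (q ^ (n %/ d)) d.
Proof.
move=> n0; apply/fsubsetP => f fP; have /fmonics_fixedP[f1 sf ff] := fP.
rewrite !in_fsetU.
have [irr_f|Nirr] := EM (irreducible_elt f).
  apply/orP; left; apply/orP; left.
  by rewrite in_fset unfold_in /= fP; apply/asboolP.
have [j [g [b [gA sg fE [b1 bb]]]]] := fixed_factor f1 sf n0 ff.
have /abs_irrP[g1 _ per_g irr_g] := gA.
have /and3P[j0 /eqP gj _] := per_g.
have N1 := monic_norm phi j g1.
have sN := msize_norm phi j g1.
have nE : n = (j * (msize g).-1 + (msize b).-1)%N.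
  have := predn_msizeM (mleadc1_neq0 N1) (mleadc1_neq0 b1).
  by rewrite -fE sf sN.
have sg' : (0 < (msize g).-1)%N by case: (msize g) sg => [|[]].
have sbE : msize b = (msize b).-1.+1 by apply: mpolySpred; apply: mleadc1_neq0.
have [sb|sb] := posnP (msize b).-1.
  have b_1 : b = 1.
    by apply: monic_unit => //; rewrite mpoly_unit_msize sbE sb.
  rewrite b_1 mulr1 in fE; rewrite sb addn0 in nE.
  apply/orP; right; apply/bigfcupP.
  have j1 : (1 < j)%N.
    rewrite ltn_neqAle j0 andbT; apply/eqP => j1; case: Nirr.
    by rewrite fE -j1 /norm /= big_seq1.
  exists (msize g).-1.
    by rewrite mem_index_iota sg' nE -[X in (X < _)%N]mul1n ltn_mul2r sg' j1 dvdn_mull.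
  rewrite nE mulnK //; apply/imfsetP; exists g => //=.
  by apply/(fmonics_iterP _ _ j0); split=> //; rewrite prednK // ltnW.
apply/orP; left; apply/orP; right; apply/bigfcupP.
have lt_i : (j * (msize g).-1 < n)%N by rewrite nE -[X in (X < _)%N]addn0 ltn_add2l.
exists (j * (msize g).-1)%N; first by rewrite mem_index_iota muln_gt0 j0 sg' lt_i.
apply/imfsetP; exists (norm phi j g, b) => //=.
rewrite in_fsetM /=; apply/andP; split; apply/fmonics_fixedP; split=> //.
- exact: norm_fixed.
- by rewrite {1}nE addKn.
Qed.

Lemma card_fmonics_cover n : (0 < n)%N ->
  (#|` fmonics K r q n| <= #|` [fset f in fmonics K r q n | `[< irreducible_elt f >]]|
    + \sum_(1 <= i < n) #|` fmonics K r q i| * #|` fmonics K r q (n - i)|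
    + \sum_(1 <= d < n | (d %| n)%N) #|` fmonics K r (q ^ (n %/ d)) d|)%N.
Proof.
move=> n0; apply: leq_trans (fsubset_leq_card (fmonics_cover n0)) _.
rewrite cardfsU; apply: leq_trans (leq_subr _ _) _; apply: leq_add.
  rewrite cardfsU; apply: leq_trans (leq_subr _ _) _; rewrite leq_add2l.
  apply: leq_trans (leq_card_bigfcup _ _ _) _; apply: leq_sum => i _.
  exact: leq_trans (leq_card_imset _ _) (leq_card_fsetM _ _).
apply: leq_trans (leq_card_bigfcup _ _ _) _; apply: leq_sum => i _.
exact: leq_card_imset.
Qed.

End AbsolutelyIrreducible.

(** * Descent from polynomials fixed by Frobenius to polynomials over the finite field *)

Section Descent.
Local Open Scope fset_scope.

Variables (r : nat) (F : finFieldType) (K : closedFieldType) (iota : {rmorphism F -> K}).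
Variable phi : {rmorphism K -> K}.
Hypothesis phiE : forall x, phi x = x ^+ #|F|.

Local Notation Phi := (map_mpoly phi : {mpoly K[r]} -> {mpoly K[r]}).
Local Notation emb := (map_mpoly iota : {mpoly F[r]} -> {mpoly K[r]}).

Lemma card_finField_gt1 : (1 < #|F|)%N.
Proof. exact: finNzRing_gt1. Qed.

Lemma card_finField_eq0 : #|F|%:R = 0 :> K.
Proof.
have := pchar_card_finField iota => /(pnat_dvd (pdiv_dvd _)) Kp.
have pr_d : prime (pdiv #|F|) by rewrite pdiv_prime // card_finField_gt1.
move: Kp; rewrite pnatE // => charK.
by apply/eqP; rewrite -(dvdn_pcharf charK) pdiv_dvd.
Qed.

Lemma frob_iota c : phi (iota c) = iota c.
Proof. by rewrite phiE -rmorphXn expf_card. Qed.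

(** There are [#|F|] fixed points, and the image of [iota] already supplies that many. *)
Lemma frob_fixed x : phi x = x -> exists c, iota c = x.
Proof.
have q1 := card_finField_gt1; have q0 := card_finField_eq0.
move=> xx; have : x \in pow_fixed K #|F| by rewrite mem_pow_fixed // -phiE xx.
have -> : pow_fixed K #|F| = [fset iota c | c in [set: F]%SET].
  apply/eqP; rewrite eq_sym eqEfcard; apply/andP; split.
    apply/fsubsetP => _ /imfsetP[c _ ->].
    by rewrite mem_pow_fixed // -phiE frob_iota.
  rewrite card_pow_fixed // card_imfset; last exact: fmorph_inj.
  by rewrite /= -cardE cardsT.
by case/imfsetP=> c _ ->; exists c.
Qed.

Lemma emb_inj : injective emb.
Proof.
move=> p p' /mpolyP E; apply/mpolyP => m.
by apply: (fmorph_inj iota); rewrite -!mcoeff_map_mpoly.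
Qed.

Lemma Phi_emb p : Phi (emb p) = emb p.
Proof. by apply/mpolyP => m; rewrite !mcoeff_map_mpoly; apply: frob_iota. Qed.

Lemma Phi_fixed p : Phi p = p -> exists p', emb p' = p.
Proof.
(* The default [0] is never reached on coefficients of [p], which lie in the image of [iota]. *)
move=> pp; pose inv x := odflt 0 [pick c | iota c == x].
have invK m : iota (inv p@_m) = p@_m.
  rewrite /inv; case: pickP => [c /eqP //|no].
  have [|c cE] := @frob_fixed p@_m; first by rewrite -mcoeff_map_mpoly pp.
  by have := no c; rewrite cE eqxx.
exists (\sum_(m <- msupp p) inv p@_m *: 'X_[m]).
rewrite [RHS]mpolyE raddf_sum; apply: eq_bigr => m _.
by rewrite /= map_mpolyZ map_mpolyX invK.
Qed.

Lemma msize_emb p : msize (emb p) = msize p.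
Proof. by rewrite !msizeE; apply: perm_big; apply: msupp_map_mpoly (fmorph_inj iota). Qed.

Lemma mleadc_emb p : mleadc (emb p) = iota (mleadc p).
Proof.
rewrite mcoeff_map_mpoly; congr (iota _@__).
by apply: perm_big; apply: msupp_map_mpoly (fmorph_inj iota).
Qed.

Lemma unit_emb p : (emb p \is a GRing.unit) = (p \is a GRing.unit).
Proof. by rewrite !mpoly_unit_msize msize_emb. Qed.

Lemma finite_rel_irr_set n : finite_set (rel_irr_set iota r n).
Proof.
pose S : {fset F} := [fset x in [set: F]%SET].
have ST x : x \in S by rewrite in_fset inE.
apply: (@sub_finite_set _ _ [set` fmpoly r S n.+1]%classic); last exact: finite_fset.
by move=> p [_ sp _]; apply/fmpolyP => //; rewrite sp.
Qed.

Lemma card_rel_irr_set n : (0 < n)%N ->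
  #|` fset_set (rel_irr_set iota r n)| = #|` rel_irr r #|F| phi n|.
Proof.
move=> n0; have q1 := card_finField_gt1; have q0 := card_finField_eq0.
suff -> : rel_irr r #|F| phi n = emb @` fset_set (rel_irr_set iota r n).
  by rewrite card_imfset //; apply: emb_inj.
have in_rel_irr_set p : (p \in fset_set (rel_irr_set iota r n)) <-> rel_irr_set iota r n p.
  by rewrite in_fset_set ?in_setE //; apply: finite_rel_irr_set.
apply/fsetP => f; apply/rel_irrP/imfsetP => //.
  move=> [f1 sf ff fmul Nirr]; have [p pE] := Phi_fixed ff.
  exists p => //; apply/in_rel_irr_set; rewrite -pE in f1 sf fmul Nirr *.
  rewrite mleadc_emb in f1; rewrite msize_emb in sf.
  split=> //; first by apply: (fmorph_inj iota); rewrite rmorph1.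
  split=> //; split.
  - by rewrite -msize_poly_eq0 sf.
  - by rewrite mpoly_unit_msize sf eqSS -lt0n.
  move=> a b pab; rewrite -!unit_emb; apply: fmul; rewrite ?Phi_emb //.
  by rewrite pab rmorphM.
move=> [p /= /in_rel_irr_set[p1 sp [[_ _ pmul] Nirr]] ->].
rewrite mleadc_emb msize_emb p1 rmorph1 sp Phi_emb; split=> // a b aa bb.
have [[a' <-] [b' <-]] := (Phi_fixed aa, Phi_fixed bb).
by rewrite -rmorphM => /emb_inj/pmul; rewrite !unit_emb.
Qed.

End Descent.

(** * Estimates *)

Section BinomialInequalities.
Variable r : nat.
Hypothesis r_ge2 : (2 <= r)%N.
Local Open Scope nat_scope.

(* [N d] monomials of degree at most [d], of which [b d] have degree exactly [d]. *)
Local Notation N d := 'C(r + d, r).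
Local Notation b d := 'C(r - 1 + d, r - 1).

Lemma bin_degS d : N d.+1 = N d + b d.+1.
Proof. by case: r r_ge2 => // r' _; rewrite subn1 /= addSn binS addSnnS addnS. Qed.

Lemma bin_deg0 : N 0 = 1. Proof. by rewrite addn0 binn. Qed.

Lemma bin_mdeg1 : b 1 = r.
Proof. by case: r r_ge2 => // r' _; rewrite subn1 /= addn1 binSn. Qed.

Lemma bin_deg1 : N 1 = r.+1.
Proof. by rewrite addn1 binSn. Qed.

Lemma bin_mdeg_lt d : b d < b d.+1.
Proof.
case: r r_ge2 => [|[|s]] // _; rewrite subn1 /= addnS binS -[X in X < _]addn0 ltn_add2l.
by rewrite bin_gt0; lia.
Qed.

Lemma bin_mdeg_le d e : d <= e -> b d <= b e.
Proof.
move=> le_de; rewrite -(subnKC le_de); elim: (e - d) => [|k IHk]; first by rewrite addn0.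
by apply: leq_trans IHk _; rewrite addnS ltnW // bin_mdeg_lt.
Qed.

Lemma bin_mdeg_ge d : 0 < d -> d + r <= b d + 1.
Proof.
case: d => // d _; elim: d => [|d IHd]; first by rewrite bin_mdeg1 addnC.
by have := bin_mdeg_lt d.+1; move: (b d.+1) (b d.+2) IHd => x y; lia.
Qed.

(** By Pascal's rule the first difference of [b] is ['C(r - 1 + d, r - 2)], which is nondecreasing
    in [d]. *)
Lemma bin_mdeg_convex d : 2 * b d.+1 <= b d + b d.+2.
Proof.
case: r r_ge2 => [|[|s]] // _; rewrite subn1 /= !addnS.
have := leq_bin2l s (leqnSn (s.+1 + d)).
have := binS (s.+1 + d).+1 s; have := binS (s.+1 + d) s; lia.
Qed.

(** By convexity the last of the [d] increments of [b] from [1] to [d.+1] is the largest; recall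
    [b 1 = r]. *)
Lemma bin_mdeg_slope d : b d.+1 + d * b d <= r + d * b d.+1.
Proof.
elim: d => [|d IHd]; first by rewrite bin_mdeg1 !mul0n.
have := bin_mdeg_convex d; move: (b d) (b d.+1) (b d.+2) IHd => x y z; nia.
Qed.

(** The trapezoid bound for the sum of the convex [b] over [1, ..., d], which is [N d - 1]. *)
Lemma bin_deg_mean d : 2 * N d <= d * (r + b d) + 2.
Proof.
elim: d => [|d IHd]; first by rewrite bin_deg0.
rewrite bin_degS; have := bin_mdeg_slope d.
by move: (N d) (b d) (b d.+1) IHd => x y z; nia.
Qed.

Lemma bin_deg_add d k : N d + k * b d <= N (d + k).
Proof.
elim: k => [|k IHk]; first by rewrite addn0 mul0n addn0.
rewrite addnS bin_degS mulSn; have := @bin_mdeg_le d (d + k).+1.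
by move/(_ (leqW (leq_addr _ _))); move: (b _.+1) (N (d + k)) IHk => x y; lia.
Qed.

(* The chord slope of [d |-> N d - 1], which is convex, between [0] and [d]. *)
Lemma bin_deg_chord d m : 0 < d -> d.+2 <= m ->
  m * N d + d <= d * (N (m - 1) + r) + m.
Proof.
move=> d0 /subnKC <-; set e := m - d.+2.
have -> : d.+2 + e - 1 = d + e.+1 by lia.
have := bin_deg_add d e.+1; have := bin_deg_mean d; have := bin_mdeg_le d0.
rewrite bin_mdeg1; move: (N d) (b d) (N (d + e.+1)) => x y z h1 h2 h3.
have H1 : d * (x + e.+1 * y) <= d * z by rewrite leq_mul2l h3 orbT.
have H2 : e * d * r <= e * d * y by rewrite leq_mul2l h1 orbT.
have H3 : (e + 2) * (2 * x) <= (e + 2) * (d * (r + y) + 2) by rewrite leq_mul2l h2 orbT.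
by clearbody e; lia.
Qed.

(** Among products of two polynomials of fixed total degree, those with a linear factor have the
    largest exponent. *)
Lemma bin_deg_superadd i k : 0 < k -> N i.+1 + N k <= r.+1 + N (i + k).
Proof.
move=> k0; elim: i => [|i IHi]; first by rewrite bin_deg1.
rewrite [i.+1 + k]addSn (bin_degS i.+1) (bin_degS (i + k)).
have le_ik : i.+2 <= (i + k).+1 by lia.
have := bin_mdeg_le le_ik; move: (b i.+2) (b (i + k).+1) => x y; lia.
Qed.

(** This is [bin_deg_chord] at [m = s * d], divided by [d]; its range condition fails only for
    [s = 2], [d = 1]. *)
Lemma bin_deg_mul s d : 1 < s -> 0 < d -> s * N d + 1 <= N (s * d - 1) + r + s.
Proof.
move=> s1 d0; have [le_d|lt_d] := leqP d.+2 (s * d).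
  have := bin_deg_chord d0 le_d; move: (N d) (N _) => x y h.
  by rewrite -(leq_pmul2l d0); nia.
have [-> ->] : s = 2 /\ d = 1 by nia.
by rewrite bin_deg1; lia.
Qed.

Lemma bin_deg_gt0 d : 0 < N d.
Proof. by rewrite bin_gt0 leq_addr. Qed.

(** The left side without [m - 2] is the exponent bounding the norms from degree [d]. The slack
    [m - 2] pays for summing over all such [d]. *)
Lemma exponent_small d j l m : 0 < d -> d.+2 <= m -> j * d = l * m ->
  j * (N d - 1) + l + (m - 2) <= l * (N (m - 1) + r) + (b m - r - 1).
Proof.
move=> d0 le_dm jd.
have m0 : 0 < m by lia.
have := bin_mdeg_ge m0; have := bin_deg_chord d0 le_dm; have := bin_deg_gt0 d.
move: (N d) (N (m - 1)) (b m) => x y z x0 h1 h2.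
have h3 : d * (j * x + l) <= d * (l * (y + r) + j).
  have : l * (m * x + d) <= l * (d * (y + r) + m) by rewrite leq_mul2l h1 orbT.
  by rewrite !mulnDr !mulnA -jd; lia.
have h4 : j * x + l <= l * (y + r) + j by move: h3; rewrite leq_pmul2l.
have : j <= j * x by rewrite leq_pmulr.
rewrite mulnBr muln1; lia.
Qed.

Lemma exponent_pred j m : 1 < m -> j * (m - 1) = 2 * m ->
  j * (N (m - 1) - 1) + 2 <= 2 * (N (m - 1) + r) + (b m - r - 1).
Proof.
case: m => [|[|d]] // _; rewrite subn1 /= => jd.
have := bin_deg_mean d.+1; have := bin_mdeg_lt d.+1; have := bin_deg_gt0 d.+1.
have := bin_mdeg_le (ltn0Sn d); rewrite bin_mdeg1.
move: (N d.+1) (b d.+1) (b d.+2) => x y z ry x0 yz h.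
have h1 : d.+1 * (j * (x - 1)) <= d.+1 * (2 * (x - 1) + r + y).
  by rewrite mulnA (mulnC d.+1) jd; nia.
rewrite leq_pmul2l // in h1; lia.
Qed.

End BinomialInequalities.

(** * Upper and lower bounds for composite degree *)

Section CountingBounds.
Local Open Scope fset_scope.
Local Open Scope nat_scope.

(** Both [m] and [m - 1] divide [n], and one of them is even. *)
Lemma pdiv_eq2 n m : (1 < n)%N -> n = (pdiv n * m)%N -> (1 < m)%N -> (m - 1 %| n)%N ->
  pdiv n = 2.
Proof.
move=> n1 nE m1 dv; have pr_l := pdiv_prime n1.
have even_n : (2 %| n)%N -> pdiv n = 2.
  move=> n2; have := pdiv_min_dvd (isT : 1 < 2)%N n2; have := prime_gt1 pr_l; lia.
have [m_odd|] := boolP (odd m); last first.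
  by move=> m_even; apply: even_n; rewrite nE dvdn_mull // dvdn2.
apply: even_n; apply: dvdn_trans dv.
by rewrite dvdn2 oddB ?m_odd // ltnW.
Qed.

Variables (K : closedFieldType) (r q : nat) (phi : {rmorphism K -> K}).
Hypothesis r_ge2 : 2 <= r.
Hypotheses (q_gt1 : 1 < q) (q0 : (q%:R = 0 :> K)%R).
Hypothesis phiE : forall x, phi x = (x ^+ q)%R.
Hypothesis phi_periodic : forall x, exists2 j, 0 < j & iter j phi x = x.

Local Notation N d := 'C(r + d, r).
Local Notation b d := 'C(r - 1 + d, r - 1).
Local Notation P Q d := #|` fmonics K r Q d|.

Let q_gt0 : 0 < q. Proof. exact: ltnW. Qed.

Lemma card_fmonics_eq j d : 0 < j -> 0 < d ->
  P (q ^ j) d * (q ^ j - 1) + q ^ (j * N (d - 1)) = q ^ (j * N d).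
Proof.
move=> j0; case: d => // d _; rewrite (_ : d.+1 - 1 = d) ?subn1 // !expnM -subn1.
case: r r_ge2 => // r' _; apply: card_fmonics; [exact: qX_gt1 | exact: qX0].
Qed.

Lemma card_fmonics_le j d : 0 < j -> 0 < d -> P (q ^ j) d * (q ^ j - 1) <= q ^ (j * N d).
Proof. by move=> j0 d0; rewrite -card_fmonics_eq // leq_addr. Qed.

(** Multiply by [q ^ (j - l)] and use that [(q ^ l - 1) * q ^ (j - l)] is at most [q ^ j - 1]. *)
Lemma card_fmonics_weight l j d : 0 < l -> l <= j -> 0 < d ->
  (q ^ l - 1) * P (q ^ j) d <= q ^ (j * (N d - 1) + l).
Proof.
move=> l0 le_lj d0; have j0 : 0 < j by apply: leq_trans le_lj.
rewrite -(@leq_pmul2r (q ^ (j - l))) ?expn_gt0 ?q_gt0 // -expnD.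
have -> : j * (N d - 1) + l + (j - l) = j * N d.
  by have := bin_deg_gt0 r d; move: (N d) => x x0; rewrite -addnA subnKC // -mulnSr subn1 prednK.
apply: leq_trans (card_fmonics_le j0 d0); rewrite mulnAC mulnC leq_mul2l; apply/orP; right.
by rewrite mulnBl -expnD subnKC // mul1n leq_sub2l // expn_gt0 q_gt0.
Qed.

Lemma leq_expl k : k <= q ^ k.
Proof. exact/ltnW/ltn_expl. Qed.

Section Composite.
Variables (n l m : nat).
Hypotheses (lE : l = pdiv n) (nE : n = l * m) (m_gt1 : 1 < m) (n_gt1 : 1 < n).

Let l_gt1 : 1 < l. Proof. by rewrite lE prime_gt1 // pdiv_prime. Qed.
Let l_gt0 : 0 < l. Proof. exact: ltnW. Qed.
Let m_gt0 : 0 < m. Proof. exact: ltnW. Qed.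

(* [U = l * N m - kappa r n] *)
Let U := l * (N (m - 1) + r) + (b m - r - 1).

Lemma no_large_divisor d : d %| n -> m < d -> d < n -> False.
Proof.
case/dvdnP=> j jE lt_md lt_dn.
have j1 : 1 < j by rewrite ltnNge; apply/negP => le_j1; move: lt_dn; rewrite jE; nia.
have : pdiv n <= j by apply: pdiv_min_dvd => //; rewrite jE dvdn_mulr.
by rewrite -lE => le_lj; nia.
Qed.

Lemma norm_term d : 0 < d -> d < m -> d %| n ->
  l * (q ^ l - 1) * #|` norm phi (n %/ d) @` abs_irr r q phi (n %/ d) d|
    <= q ^ (if d == m - 1 then U else U - (m - 2)).
Proof.
move=> d0 lt_dm d_n; set j := n %/ d.
have jd : j * d = l * m by rewrite divnK.
have lt_lj : l < j by rewrite ltnNge; apply/negP => le_jl; nia.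
have j0 : 0 < j by apply: leq_trans lt_lj.
have le_exp : (q ^ l - 1) * P (q ^ j) d <= q ^ (j * (N d - 1) + l).
  exact: card_fmonics_weight (ltnW lt_lj) _.
have le_card : l * #|` norm phi j @` abs_irr r q phi j d| <= P (q ^ j) d.
  apply: (@leq_trans #|` abs_irr r q phi j d|).
    rewrite (card_norm_abs_irr r q_gt1 q0 phiE phi_periodic) mulnC.
    by rewrite leq_mul2l (ltnW lt_lj) orbT.
  by apply: fsubset_leq_card; apply/fsubsetP => g; rewrite inE => /andP[].
rewrite mulnAC mulnC; apply: leq_trans (leq_trans (leq_mul (leqnn _) le_card) le_exp) _.
apply: leq_pexp2l => //; case: eqP => [dE|neq].
  have l2 : l = 2.
    rewrite lE; apply: (pdiv_eq2 n_gt1 (m := m)) => //; first by rewrite -lE.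
    by rewrite -dE.
  rewrite /U dE l2; apply: exponent_pred => //.
  by rewrite -dE jd l2.
have le_dm : d.+2 <= m by lia.
have := exponent_small r_ge2 d0 le_dm jd; rewrite -/U; lia.
Qed.

(** Ensures that the truncated difference [U - (m - 2)] is a true one. *)
Lemma slack_le_U : (m - 2) <= U.
Proof. by have := bin_mdeg_ge r_ge2 m_gt0; rewrite /U; lia. Qed.

(** The divisor [d = m] gives the main term and no proper divisor exceeds [m]. The term [d = m - 1]
    costs at most [q ^ U]; the [m - 2] smaller ones cost [q ^ (U - (m - 2))] each, together at most
    [q ^ U]. *)
Lemma rel_irr_upper :
  l * (q ^ l - 1) * #|` rel_irr r q phi n| <= q ^ (l * N m) + 3 * q ^ U.
Proof.
have n0 : 0 < n by apply: ltnW.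
apply: (@leq_trans (l * (q ^ l - 1) * \sum_(1 <= d < n | d %| n)
     #|` norm phi (n %/ d) @` abs_irr r q phi (n %/ d) d|)).
  by rewrite leq_mul2l card_rel_irr_le ?orbT.
have lt_mn : m < n by rewrite nE; nia.
rewrite (big_cat_nat _ (n := m.+1)) //=.
rewrite [X in _ + X]big_nat_cond [X in _ + X]big1 ?addn0; last first.
  by move=> d /andP[/andP[lt_md lt_dn] d_n]; case: (no_large_divisor d_n).
rewrite big_mkcond big_nat_recr //= -big_mkcond /= mulnDr addnC; apply: leq_add.
  have -> : m %| n by rewrite nE dvdn_mull.
  rewrite nE mulnK // mulnAC mulnC [l * _]mulnC.
  rewrite -(card_norm_abs_irr r q_gt1 q0 phiE phi_periodic) mulnC.
  apply: leq_trans (card_fmonics_le l_gt0 m_gt0); rewrite leq_mul2r; apply/orP; right.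
  by apply: fsubset_leq_card; apply/fsubsetP => g; rewrite inE => /andP[].
rewrite big_distrr /=.
apply: (@leq_trans (\sum_(1 <= d < m) q ^ (if d == m - 1 then U else U - (m - 2)))).
  rewrite [X in _ <= X](bigID (fun d => d %| n)) /=; apply: leq_trans (leq_addr _ _).
  rewrite big_nat_cond [X in _ <= X]big_nat_cond; apply: leq_sum => d.
  by case/andP=> /andP[d0 lt_dm] d_n; apply: norm_term.
have -> : m = (m - 1).+1 by lia.
rewrite big_nat_recr /=; last by lia.
rewrite subSS subn0 eqxx; apply: (@leq_trans (q ^ U + q ^ U)); last by lia.
rewrite leq_add2r.
rewrite big_nat_cond (eq_bigr (fun=> q ^ (U - (m - 2)))); last first.
  by move=> d /andP[/andP[_ lt_d] _]; rewrite ltn_eqF //; congr (q ^ (U - _)); lia.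
rewrite -big_nat_cond sum_nat_const_nat.
have {2}-> : U = (m - 2) + (U - (m - 2)) by rewrite subnKC // slack_le_U.
rewrite expnD leq_mul2r; apply/orP; right; apply: leq_trans (leq_expl _).
by lia.
Qed.

Hypothesis q_char : ([pchar K]%R).-nat q.

(** Apply [card_fmonics_cover] to the [l]-th iterate of Frobenius, then discard the irreducible
    polynomials already defined over the field with [q] elements. *)
Lemma card_abs_irr_lower :
  P (q ^ l) m <= #|` abs_irr r q phi l m| + P q m
    + \sum_(1 <= i < m) P (q ^ l) i * P (q ^ l) (m - i)
    + \sum_(1 <= d < m | d %| m) P (q ^ (l * (m %/ d))) d.
Proof.
have [phil philE] : exists phil : {rmorphism K -> K}, forall x, phil x = (x ^+ (q ^ l))%R.
  by apply: frobenius_exists; rewrite pnatX q_char.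
have phil_periodic x : exists2 j, 0 < j & iter j phil x = x.
  have [j j0 xj] := phi_periodic x; exists j => //.
  rewrite (iter_expr _ _ philE) -expnM -(iter_expr _ _ phiE).
  exact: iter_mul_fix.
have := card_fmonics_cover r (qX_gt1 q_gt1 l_gt0) (qX0 q0 l_gt0) philE phil_periodic m_gt0.
move=> /leq_trans -> //; rewrite leq_add //.
  rewrite leq_add2r.
  have pr_l : prime l by rewrite lE pdiv_prime.
  apply: leq_trans (fsubset_leq_card (irreducible_prime_period _ _ _ _ _ _ pr_l)) _ => //.
  by rewrite cardfsU leq_subr.
by apply: leq_sum => d _; rewrite expnM.
Qed.

(** A common scale for the reducible and the conjugate terms; [m - 1] copies of it fit into
    [q ^ U]. *)
Let M := q ^ (l * (N (m - 1) + r)).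

Lemma M_le_U : (m - 1) * M <= q ^ U.
Proof.
rewrite /U expnD mulnC leq_mul2l; apply/orP; right.
apply: (@leq_trans (2 ^ (m - 2))).
  have -> : m - 1 = (m - 2).+1 by lia.
  exact: ltn_expl.
apply: (@leq_trans (q ^ (m - 2))); first by case: (m - 2) => // k; rewrite leq_exp2r.
by apply: leq_pexp2l => //; have := bin_mdeg_ge r_ge2 m_gt0; lia.
Qed.

(** With [Q = q ^ l], the two counts give the bound [M * Q / (Q - 1)], and [Q >= 4] makes the
    fraction at most [4 / 3]. *)
Lemma reducible_term i : 0 < i < m ->
  3 * ((q ^ l - 1) * (P (q ^ l) i * P (q ^ l) (m - i))) <= 4 * M.
Proof.
case/andP=> i0 lt_im.
have h1 := card_fmonics_le l_gt0 i0.
have h2 : P (q ^ l) (m - i) * (q ^ l - 1) <= q ^ (l * N (m - i)).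
  by apply: card_fmonics_le => //; rewrite subn_gt0.
have h3 : q ^ (l * N i) * q ^ (l * N (m - i)) <= q ^ l * M.
  rewrite -!expnD -mulnDr -mulnS; apply: leq_pexp2l => //; rewrite leq_mul2l.
  have -> : i = i.-1.+1 by rewrite prednK.
  have mi0 : 0 < m - i.-1.+1 by rewrite prednK // subn_gt0.
  have := bin_deg_superadd r_ge2 i.-1 mi0.
  have -> : i.-1 + (m - i.-1.+1) = m - 1 by lia.
  by move=> h; apply/orP; right; move: h; rewrite addnC [N (m - 1) + r]addnC.
have Q4 : 4 <= q ^ l.
  by apply: (@leq_trans (2 ^ 2)) => //; apply: (@leq_trans (q ^ 2));
    rewrite ?leq_exp2r // leq_pexp2l.
move: (P (q ^ l) (m - i)) (P (q ^ l) i) h1 h2 => y x h1 h2.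
move: (q ^ l) h1 h2 h3 Q4 => Q h1 h2 h3 Q4.
rewrite -(@leq_pmul2r (Q - 1)); last by lia.
have h4 : (x * (Q - 1)) * (y * (Q - 1)) <= Q * M.
  exact: leq_trans (leq_mul h1 h2) h3.
have -> : 3 * ((Q - 1) * (x * y)) * (Q - 1) = 3 * (x * (Q - 1) * (y * (Q - 1))).
  by lia.
apply: (@leq_trans (3 * (Q * M))); first by rewrite leq_mul2l h4 orbT.
have -> : 4 * M * (Q - 1) = (4 * (Q - 1)) * M by lia.
by rewrite mulnA leq_mul2r; apply/orP; right; lia.
Qed.

Lemma conjugate_term d : 0 < d < m -> d %| m ->
  (q ^ l - 1) * P (q ^ (l * (m %/ d))) d <= M.
Proof.
case/andP=> d0 lt_dm d_m; set s := m %/ d.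
have sd : s * d = m by rewrite divnK.
have s1 : 1 < s by rewrite ltnNge; apply/negP => le_s1; nia.
apply: leq_trans (card_fmonics_weight l_gt0 _ d0) _; first by rewrite leq_pmulr // ltnW.
apply: leq_pexp2l => //; rewrite -mulnA -mulnSr leq_mul2l; apply/orP; right.
have := bin_deg_mul r_ge2 s1 d0; rewrite sd; have := bin_deg_gt0 r d.
by move: (N d) (N (m - 1)) => x y x0 h; rewrite mulnBr muln1; nia.
Qed.

Lemma rel_irr_lower :
  q ^ (l * N m) <= l * (q ^ l - 1) * #|` rel_irr r q phi n| + 3 * q ^ U.
Proof.
have N_ge : r.+1 <= N (m - 1).
  rewrite -(bin_deg1 r); have -> : m - 1 = 1 + (m - 2) by lia.
  exact: leq_trans (leq_addr _ _) (bin_deg_add r_ge2 _ _).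
have b_ge := bin_mdeg_ge r_ge2 m_gt0.
(* The four losses are at most [1/16], [1/4], [4/3] and [1] times [q ^ U], with sum below [3]. The
   first is the lower-order term in the exact count of monic polynomials. *)
have t0 : 16 * q ^ (l * N (m - 1)) <= q ^ U.
  apply: (@leq_trans (q ^ (4 + l * N (m - 1)))).
    by rewrite expnD leq_mul2r (@leq_exp2r 2 q 4) // q_gt1 orbT.
  by apply: leq_pexp2l => //; rewrite /U; move: (N _) (b m) N_ge b_ge => x y; nia.
have t1 : 4 * ((q ^ l - 1) * P q m) <= q ^ U.
  have h1 : P q m <= q ^ N m.
    have := @card_fmonics_le 1 m isT m_gt0; rewrite expn1 mul1n => /(leq_trans _) -> //.
    by rewrite leq_pmulr // subn_gt0.
  apply: (@leq_trans (q ^ (2 + (l + N m)))).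
    rewrite !expnD; apply: leq_mul; first by rewrite (@leq_exp2r 2 q 2).
    by apply: leq_mul => //; apply: leq_subr.
  apply: leq_pexp2l => //; have -> : m = (m - 1).+1 by lia.
  rewrite (bin_degS r_ge2) /U; have -> : (m - 1).+1 = m by lia.
  by move: (N _) (b m) N_ge b_ge => x y; nia.
have t2 : 3 * ((q ^ l - 1) * \sum_(1 <= i < m) P (q ^ l) i * P (q ^ l) (m - i)) <= 4 * q ^ U.
  apply: leq_trans (leq_mul (leqnn 4) M_le_U); rewrite !big_distrr /= mulnCA.
  rewrite -sum_nat_const_nat big_nat_cond [X in _ <= X]big_nat_cond.
  by apply: leq_sum => i /andP[im _]; apply: reducible_term.
have t3 : (q ^ l - 1) * \sum_(1 <= d < m | d %| m) P (q ^ (l * (m %/ d))) d <= q ^ U.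
  apply: leq_trans M_le_U; rewrite big_distrr /= -sum_nat_const_nat.
  rewrite [X in _ <= X](bigID (fun d => d %| m)) /=; apply: leq_trans (leq_addr _ _).
  rewrite big_nat_cond [X in _ <= X]big_nat_cond; apply: leq_sum => d.
  by case/andP=> dm d_m; apply: conjugate_term.
have lower := card_abs_irr_lower.
have rel : #|` abs_irr r q phi l m| <= #|` rel_irr r q phi n| * l.
  by rewrite nE; apply: card_rel_irr_ge.
rewrite -card_fmonics_eq //.
set S2 := \sum_(1 <= i < m) _ in t2 lower; set S3 := \sum_(1 <= d < m | _) _ in t3 lower.
set A := #|` abs_irr _ _ _ _ _| in lower rel; set E := #|` rel_irr _ _ _ _| in rel *.
set y := P q m in t1 lower; set x := P (q ^ l) m in lower *.
set T0 := q ^ (l * _) in t0 *; set c := q ^ l - 1 in t1 t2 t3 *.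
move: (q ^ U) t0 t1 t2 t3 => V t0 t1 t2 t3.
clearbody S2 S3 A E y x T0 c; clear -t0 t1 t2 t3 lower rel.
have h : x * c <= (E * l + y + S2 + S3) * c.
  by rewrite leq_mul2r (leq_trans lower) ?orbT // !leq_add2r.
lia.
Qed.

End Composite.
End CountingBounds.

(** * Exact count in prime degree *)

Section PrimeDegree.
Local Open Scope fset_scope.
Local Open Scope nat_scope.

Lemma irreducible_degree1 (k : fieldType) (n : nat) (f : {mpoly k[n]}) :
  msize f = 2 -> irreducible_elt f.
Proof.
move=> sf; have f0 : f != 0%R by rewrite -msize_poly_eq0 sf.
split=> //; first by rewrite mpoly_unit_msize sf.
move=> a b fE; move: f0; rewrite fE mulf_eq0 negb_or => /andP[a0 b0].
have := predn_msizeM a0 b0; rewrite -fE sf !mpoly_unit_msize.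
rewrite (mpolySpred _ a0) (mpolySpred _ b0) /=.
by move: (msize a).-1 (msize b).-1 => [|x] [|y]; rewrite ?addSn ?addnS // => _; [left | right].
Qed.

Variables (K : closedFieldType) (r q : nat) (phi : {rmorphism K -> K}).
Hypotheses (q_gt1 : 1 < q) (q0 : (q%:R = 0 :> K)%R).
Hypothesis phiE : forall x, phi x = (x ^+ q)%R.
Hypothesis phi_periodic : forall x, exists2 j, 0 < j & iter j phi x = x.

(** Every linear polynomial is irreducible. Over the field with [q ^ n] elements its orbit has
    length [1] or [n], and the orbits of length [n] correspond to the relatively irreducible
    polynomials. *)
Lemma card_rel_irr_prime n : prime n ->
  n * #|` rel_irr r q phi n| + #|` fmonics K r q 1| = #|` fmonics K r (q ^ n) 1|.
Proof.
move=> pr_n; have n1 := prime_gt1 pr_n; have n0 := prime_gt0 pr_n.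
have -> : n * #|` rel_irr r q phi n| = #|` abs_irr r q phi n 1|.
  apply/eqP; rewrite eqn_leq; apply/andP; split; last first.
    have := card_rel_irr_ge r q_gt1 q0 phiE phi_periodic n1 (isT : 0 < 1).
    by rewrite muln1 mulnC.
  rewrite (card_norm_abs_irr r q_gt1 q0 phiE phi_periodic) mulnC leq_mul2r.
  apply/orP; right; apply: leq_trans (card_rel_irr_le r q_gt1 q0 phiE phi_periodic n0) _.
  rewrite big_ltn_cond // dvd1n divn1 big_nat_cond big1 ?addn0 //.
  move=> d /andP[/andP[d1 lt_dn] /(prime_nt_dvdP pr_n)].
  by move=> /(_ (negbT (gtn_eqF d1))) E; rewrite E ltnn in lt_dn.
rewrite -cardfsUI.
have -> : abs_irr r q phi n 1 `&` fmonics K r q 1 = fset0.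
  apply/fsetP => f; rewrite in_fsetI in_fset0; apply/negP => /andP[].
  move=> /(abs_irrP q_gt1 q0 phiE)[_ _ per_f _] /(fmonics_fixedP q_gt1 q0 phiE)[_ _ ff].
  have n_1 : n %| 1 by apply: (@exact_period_dvd _ _ _ 1 _ _ per_f).
  by move: n1; rewrite (eqP (etrans (esym (dvdn1 n)) n_1)).
rewrite cardfs0 addn0.
suff -> : abs_irr r q phi n 1 `|` fmonics K r q 1 = fmonics K r (q ^ n) 1 by [].
apply/eqP; rewrite eqEfsubset; apply/andP; split.
  rewrite fsubUset; apply/andP; split.
    by apply/fsubsetP => f; rewrite in_fset unfold_in => /andP[].
  apply/fsubsetP => f /(fmonics_fixedP q_gt1 q0 phiE)[f1 sf ff].
  by apply/(fmonics_iterP q_gt1 q0 phiE _ _ n0); split=> //; apply: iter_Phi_fix.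
apply: (fsubset_trans _ (irreducible_prime_period r q_gt1 q0 phiE phi_periodic 1 pr_n)).
apply/fsubsetP => f fP; rewrite in_fset unfold_in /= fP; apply/asboolP.
apply: irreducible_degree1.
by have /(fmonics_iterP q_gt1 q0 phiE _ _ n0)[] := fP.
Qed.

End PrimeDegree.

(** * From counting identities to rational formulas *)

Section RationalForm.
Implicit Types n E : nat.

Lemma prime_count_formula (r q n E p1 pn : nat) : (1 < q)%N -> (0 < n)%N ->
    (n * E + p1 = pn)%N -> (p1 * (q - 1) + q = q ^ r.+1)%N ->
    (pn * (q ^ n - 1) + q ^ n = q ^ (n * r.+1))%N ->
  let Q : rat := q%:R in
  let eps : rat := Q ^+ (n * r) / (n%:R * (1 - Q ^- n)) in
  (0 < r)%N ->
  E%:R = eps * (1 - Q ^- (n * r)) *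
          (1 - Q ^- (r * (n - 1)) *
               (((1 - Q ^- r) * (1 - Q ^- n)) /
                ((1 - Q ^- 1) * (1 - Q ^- (n * r)))))
  /\ 0 <= eps - E%:R <= eps * (3%:R * Q ^- (r * (n - 1))).
Proof.
move=> q1 n0 nE p1E pnE Q eps r0.
have Q1 : 1 < Q by rewrite ltr1n.
have Q0 : 0 < Q by apply: lt_trans Q1.
have qn1 : (0 < q ^ n)%N by rewrite expn_gt0 ltnW.
have {}p1E : (p1%:R * (Q - 1) + Q = Q * Q ^+ r :> rat).
  by rewrite -exprS /Q -natrX -p1E natrD natrM natrB // ltnW.
have {}pnE : (pn%:R * (Q ^+ n - 1) + Q ^+ n = Q ^+ n * Q ^+ (n * r) :> rat).
  by rewrite -exprD -mulnS /Q -!natrX -pnE natrD natrM natrB.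
have {}nE : (n%:R * E%:R + p1%:R = pn%:R :> rat) by rewrite -nE natrD natrM.
have A1 : 1 < Q ^+ n by rewrite exprn_egt1 // -lt0n.
have C1 : 1 < Q ^+ r by rewrite exprn_egt1 // -lt0n.
have B1 : 1 < Q ^+ (n * r) by rewrite exprn_egt1 // muln_eq0 negb_or -!lt0n n0.
have n0' : 0 < n%:R :> rat by rewrite ltr0n.
have BCE : Q ^- (r * (n - 1)) = Q ^+ r / Q ^+ (n * r).
  have -> : (n * r = r * (n - 1) + r)%N by rewrite -mulnSr mulnC; congr muln; lia.
  by rewrite exprD invfM mulrCA mulfV ?mulr1 // expf_neq0 // gt_eqF.
rewrite /eps BCE expr1.
move: (Q ^+ n) (Q ^+ r) (Q ^+ (n * r)) A1 C1 B1 p1E pnE => A C B A1 C1 B1 p1E pnE.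
have E_eq : E%:R = (pn%:R - p1%:R) / n%:R :> rat.
  by rewrite -nE addrK mulrC mulKf // gt_eqF.
have pn_eq : pn%:R = (A * B - A) / (A - 1).
  by rewrite -pnE addrK mulfK // subr_eq0 gt_eqF.
have p1_eq : p1%:R = (Q * C - Q) / (Q - 1).
  by rewrite -p1E addrK mulfK // subr_eq0 gt_eqF.
have nz (x : rat) : 1 < x -> (x != 0) * (x - 1 != 0).
  by move=> x1; rewrite gt_eqF ?(lt_trans _ x1) // subr_eq0 gt_eqF.
have [[zA zA1] [zB zB1]] := (nz _ A1, nz _ B1).
have [[zC _] [zQ zQ1]] := (nz _ C1, nz _ Q1).
have zn : n%:R != 0 :> rat by rewrite gt_eqF.
split.
  by rewrite E_eq pn_eq p1_eq; field; rewrite zn zQ zQ1 zA zA1 zB zB1 zC.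
(* This form of the gap is visibly positive. With [Q / (Q - 1)] at most [2] and [A / (A - 1)] at
   least [1], it is bounded by [3 * C * (A / (A - 1)) / n]. *)
have -> : B / (n%:R * (1 - A^-1)) - E%:R = (A / (A - 1) + Q * (C - 1) / (Q - 1)) / n%:R.
  by rewrite E_eq pn_eq p1_eq; field; rewrite zn zQ1 zA zA1.
have -> : B / (n%:R * (1 - A^-1)) * (3%:R * (C / B)) = (3%:R * C * (A / (A - 1))) / n%:R.
  by field; rewrite zn zA zA1 zB.
have A0 : 0 < A / (A - 1) by rewrite divr_gt0 ?subr_gt0 // (lt_trans _ A1).
have A_ge1 : 1 <= A / (A - 1).
  by rewrite ler_pdivlMr ?subr_gt0 // mul1r lerBlDr lerDl.
have Q2 : Q * (C - 1) / (Q - 1) <= 2 * (C - 1).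
  rewrite ler_pdivrMr ?subr_gt0 //.
  have : 2 <= Q by rewrite ler_nat.
  nra.
apply/andP; split.
  rewrite divr_ge0 ?ler0n // addr_ge0 ?ltW // divr_gt0 ?subr_gt0 //.
  by rewrite mulr_gt0 // subr_gt0.
rewrite ler_pM2r ?invr_gt0 //; nra.
Qed.

(** Divide both integer bounds by [c = l * (q ^ l - 1)]: the main term becomes [eps], and [q ^ U]
    becomes [eps * q ^ (- kap)]. *)
Lemma composite_count_bound (q l E X U : nat) (kap : int) : (1 < q)%N -> (0 < l)%N ->
    (l * (q ^ l - 1) * E <= q ^ (l * X) + 3 * q ^ U)%N ->
    (q ^ (l * X) <= l * (q ^ l - 1) * E + 3 * q ^ U)%N ->
    (0 < X)%N -> U%:Z = (l * X)%:Z - kap ->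
  forall Q eps : rat, Q = q%:R -> eps = Q ^+ (l * (X - 1)) / (l%:R * (1 - Q ^- l)) ->
  `|E%:R - eps| <= eps * (3%:R * Q ^ (- kap)).
Proof.
move=> q1 l0 up lo X0 UE Q eps QE epsE0.
have Q1 : 1 < Q by rewrite QE ltr1n.
have zQ : Q != 0 by rewrite gt_eqF // (lt_trans _ Q1).
have A1 : 1 < Q ^+ l by rewrite exprn_egt1 // -lt0n.
have zA : Q ^+ l != 0 by rewrite expf_neq0.
have A0 : 0 < Q ^+ l - 1 by rewrite subr_gt0.
have l0' : 0 < l%:R :> rat by rewrite ltr0n.
pose c := l%:R * (Q ^+ l - 1).
have c0 : 0 < c by rewrite mulr_gt0.
have epsE : eps = Q ^+ (l * X) / c.
  have -> : (l * X = l * (X - 1) + l)%N by rewrite -mulnSr; congr muln; lia.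
  rewrite epsE0 /c exprD; field; rewrite zA (gt_eqF l0') /=.
  by rewrite gt_eqF.
have kapE : Q ^+ (l * X) * Q ^ (- kap) = Q ^+ U.
  by rewrite -[Q ^+ (l * X)]/(Q ^ (l * X)%:Z) -expfzDr // -UE.
have cE : c = (l * (q ^ l - 1))%:R.
  by rewrite natrM natrB ?natrX -?QE // expn_gt0 ltnW.
move: up lo; rewrite -!(ler_nat rat) !natrD !natrM -!natrM.
rewrite [(l * _ * E)%:R]natrM -cE !natrX -QE => up lo.
rewrite -(ler_pM2l c0) epsE -{1}(gtr0_norm c0) -normrM mulrBr.
have -> : c * (Q ^+ (l * X) / c * (3%:R * Q ^ (- kap))) = 3%:R * Q ^+ U.
  by rewrite -kapE; field; rewrite gt_eqF.
rewrite mulrCA mulfV ?mulr1 ?gt_eqF // ler_norml; apply/andP; split; lra.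
Qed.

End RationalForm.

(** [integralRange iota] makes the algebraically closed [K] an algebraic closure of [F]. As
    [fset_set] sends infinite sets to the empty one, finiteness of each [E n] is part of the
    conclusion. *)
Theorem theorem6p5 (r q : nat) (F : finFieldType) (K : closedFieldType)
    (iota : {rmorphism F -> K}) (r_ge2 : (2 <= r)%N) (cardF : #|F| = q)
    (algK : integralRange iota) :
  let E (n : nat) : set {mpoly F[r]} := rel_irr_set iota r n in
  let cardE (n : nat) : rat := (#|` fset_set (E n)|)%:R in
  let Q : rat := q%:R in
  [/\ forall n : nat, finite_set (E n),
      cardE 1%N = 0,
      forall n : nat, prime n ->
        cardE n = epsilon r n q * (1 - Q ^- (n * r)) *
          (1 - Q ^- (r * (n - 1)) *
               (((1 - Q ^- r) * (1 - Q ^- n)) /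
                ((1 - Q ^- 1) * (1 - Q ^- (n * r)))))
        /\ 0 <= epsilon r n q - cardE n
             <= epsilon r n q * (3%:R * Q ^- (r * (n - 1)))
    & forall n : nat, (2 <= n)%N -> ~~ prime n ->
        `|cardE n - epsilon r n q|
          <= epsilon r n q * (3%:R * Q ^ (- kappa r n))].
Proof.
move=> E cardE Q.
have q1 : (1 < q)%N by rewrite -cardF card_finField_gt1.
have q0 : q%:R = 0 :> K by rewrite -cardF (card_finField_eq0 iota).
have q_char : [pchar K].-nat q by rewrite -cardF; apply: pchar_card_finField.
have [phi phiE] := frobenius_exists q_char.
have phiE' x : phi x = x ^+ #|F| by rewrite cardF.
have periodic := frobenius_periodic algK (frob_iota iota phiE').
have cardE_eq n : (0 < n)%N -> cardE n = #|` rel_irr r q phi n|%:R.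
  by move=> n0; rewrite /cardE /E (card_rel_irr_set r iota phiE') // cardF.
have r0 : (0 < r)%N by apply: ltnW.
split.
- by move=> n; apply: finite_rel_irr_set.
- by rewrite cardE_eq // (rel_irr1 r q1 q0 phiE periodic) cardfs0.
- move=> n pr_n; have n0 := prime_gt0 pr_n; rewrite cardE_eq //.
  have epsE : epsilon r n q = Q ^+ (n * r) / (n%:R * (1 - Q ^- n)).
    by rewrite /epsilon pdiv_id // divnn n0 bin_deg1 subn1.
  have count := card_rel_irr_prime r q1 q0 phiE periodic pr_n.
  rewrite epsE; apply: (prime_count_formula q1 n0 count) => //.
  + have := @card_fmonics_eq K r q r_ge2 q1 q0 1 1 isT isT.
    by rewrite !mul1n subnn bin_deg0 !expn1 bin_deg1.
  + have := @card_fmonics_eq K r q r_ge2 q1 q0 n 1 n0 isT.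
    by rewrite subnn bin_deg0 muln1 bin_deg1.
- move=> n n2 Nprime; rewrite cardE_eq ?(ltnW n2) //.
  set l := pdiv n; pose m := (n %/ l)%N.
  have nE : n = (l * m)%N by rewrite mulnC divnK // pdiv_dvd.
  have pr_l : prime l by rewrite pdiv_prime.
  have m1 : (1 < m)%N.
    rewrite ltnNge; apply/negP => le_m1; case/negP: Nprime.
    have mE : m = 1%N by move: n2; rewrite nE; case: m le_m1 {nE} => [|[|]] //; rewrite muln0.
    by rewrite nE mE muln1.
  have m0 := ltnW m1; have b_ge := bin_mdeg_ge r_ge2 m0.
  have upper := rel_irr_upper r_ge2 q1 q0 phiE periodic (erefl l) nE m1 n2.
  have lower := rel_irr_lower r_ge2 q1 q0 phiE periodic (erefl l) nE m1 n2 q_char.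
  apply: (composite_count_bound q1 (prime_gt0 pr_l) upper lower (bin_deg_gt0 r m)) => //.
  rewrite /kappa -/l -/m.
  (* Substituting [N m = N (m - 1) + b m] turns [l * N m - kappa r n] into [U]; [b_ge] makes the
     truncated subtraction in [U] exact. *)
  have := bin_degS r_ge2 (m - 1); rewrite subn1 prednK // => NE.
  rewrite NE; move: b_ge; rewrite !subn1.
  move: ('C(r + m.-1, r)) ('C(r.-1 + m, r.-1)) => x y b_ge.
  by nia.
Qed.
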